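(* Let $X$ be a separable Banach space not containing a copy of $\ell_1$. Then $X$ has property $(m_\infty)$ if and only if, for any $\varepsilon>0$, there is a subspace $X_0$ of $c_0$ with $d(X,X_0)<1+\varepsilon$.
   Context: A separable Banach space $X$ has property $(m_\infty)$ if $\limsup_n\|x+x_n\|=\max(\|x\|,\limsup_n\|x_n\|)$ whenever $x\in X$ and $x_n\to0$ weakly in $X$. $d(X,Y)=\inf\|T\|\,\|T^{-1}\|$, over all surjective isomorphisms $T:X\to Y$, is the Banach–Mazur distance. ''Not containing a copy of $\ell_1$'' means having no closed subspace isomorphic to $\ell_1$. *)

(* Defs.v *)
From HB Require Import structures.
From mathcomp Require Import all_boot all_order all_algebra.
From mathcomp Require Import all_classical all_reals all_analysis.
From mathcomp Require Import complex.

Set Implicit Arguments.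
Unset Strict Implicit.
Unset Printing Implicit Defensive.

Import Order.TTheory GRing.Theory Num.Theory.
Import numFieldNormedType.Exports.

Local Open Scope classical_set_scope.
Local Open Scope ring_scope.

(* Banach spaces are real or complex; all notions below are parameterized by
   the choice of scalars. *)
Variant scalar_kind := RealScalars | ComplexScalars.

Definition scalars (R : realType) (k : scalar_kind) : numFieldType :=
  match k with RealScalars => R | ComplexScalars => R[i] end.

Definition of_real (R : realType) (k : scalar_kind) : R -> scalars R k :=
  match k return R -> scalars R k with
  | RealScalars => fun x => x
  | ComplexScalars => fun x => Complex x 0
  end.

Definition real_part (R : realType) (k : scalar_kind) : scalars R k -> R :=
  match k return scalars R k -> R with
  | RealScalars => fun x => x
  | ComplexScalars => @complex.Re R
  end.

(* The library norm of a module over K takes its values in K; [rnorm] is the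
   same norm seen as a real number (see [rnormK]). *)
Definition rnorm (R : realType) (k : scalar_kind)
    (V : normedZmodType (scalars R k)) (x : V) : R :=
  real_part `|x|.

Section scalars_theory.
Context {R : realType} {k : scalar_kind}.
Local Notation K := (scalars R k).

Lemma of_realK : cancel (@of_real R k) (@real_part R k).
Proof. by rewrite /of_real /real_part; case: k. Qed.

Lemma of_realD x y : of_real k (x + y) = of_real k x + of_real k y :> K.
Proof. by case: k => //=; apply/eqP; rewrite eq_complex /= addr0 !eqxx. Qed.

Lemma of_realM x y : of_real k (x * y) = of_real k x * of_real k y :> K.
Proof.
by case: k => //=; apply/eqP; rewrite eq_complex /= !(mulr0, mul0r) subr0 addr0 !eqxx.
Qed.

Lemma of_real0 : of_real k 0 = 0 :> K.
Proof. by case: k. Qed.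

Lemma of_real1 : of_real k 1 = 1 :> K.
Proof. by case: k. Qed.

Lemma ler_of_real x y : (of_real k x <= of_real k y :> K) = (x <= y).
Proof. by case: k => //=; exact: lecR. Qed.

Lemma real_partK (a : K) : 0 <= a -> of_real k (real_part a) = a.
Proof.
by case: k a => //= -[a b]; rewrite lecE /= => /andP[/eqP-> _].
Qed.

Section normed.
Context {V : normedZmodType K}.
Implicit Types x y : V.

Lemma rnormK x : of_real k (rnorm x) = `|x|.
Proof. exact: real_partK. Qed.

Lemma rnorm_ge0 x : 0 <= rnorm x.
Proof. by rewrite -ler_of_real rnormK of_real0. Qed.

Lemma ler_rnormD x y : rnorm (x + y) <= rnorm x + rnorm y.
Proof. by rewrite -ler_of_real of_realD !rnormK ler_normD. Qed.

Lemma rnorm0 : rnorm (0 : V) = 0.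
Proof. by rewrite /rnorm normr0 -of_real0 of_realK. Qed.

Lemma rnorm0_eq0 x : rnorm x = 0 -> x = 0.
Proof. by move=> x0; apply/normr0_eq0; rewrite -rnormK x0 of_real0. Qed.

End normed.

Lemma rnormM (a b : K) : rnorm (a * b) = rnorm a * rnorm b.
Proof.
by apply: (can_inj of_realK); rewrite of_realM !rnormK normrM.
Qed.

End scalars_theory.

(* A linear subspace S of V is a [submodClosed V]; [subspace_of S] is S with
   the norm of V. *)
Section subspace_of.
Context {K : numFieldType} {V : normedModType K}.

Definition subspace_of (S : submodClosed V) : Type := {x : V | x \in S}.

Variable S : submodClosed V.

HB.instance Definition _ := SubType.on (subspace_of S).
HB.instance Definition _ := [Choice of subspace_of S by <:].
HB.instance Definition _ := [SubChoice_isSubLmodule of subspace_of S by <:].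

Let norm (x : subspace_of S) : K := `|val x|.

Let ler_normD x y : norm (x + y) <= norm x + norm y.
Proof. exact: ler_normD. Qed.

Let normrZ (a : K) x : norm (a *: x) = `|a| * norm x.
Proof. exact: normrZ. Qed.

Let normr0_eq0 x : norm x = 0 -> x = 0.
Proof. by move/normr0_eq0 => x0; exact: val_inj. Qed.

HB.instance Definition _ :=
  Lmodule_isNormed.Build K (subspace_of S) ler_normD normrZ normr0_eq0.

Lemma subspace_normE (x : subspace_of S) : `|x| = `|val x|.
Proof. by []. Qed.

End subspace_of.

Section c0.
Variables (R : realType) (k : scalar_kind).
Local Notation K := (scalars R k).

Definition c0_pred : {pred nat -> K} :=
  [pred u | `[< u n @[n --> \oo] --> (0 : K) >]].

Let c0_submod : submod_closed c0_pred.
Proof.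
split=> [|a u v]; rewrite !inE; first exact: cvg_cst.
move=> u0 v0.
have := cvgD (cvgM (cvg_cst a) u0) v0.
by rewrite mulr0 addr0; exact.
Qed.

HB.instance Definition _ := GRing.isSubmodClosed.Build K (nat -> K) c0_pred
  c0_submod.

Definition c0 : Type := {u : nat -> K | u \in c0_pred}.

HB.instance Definition _ := SubType.on c0.
HB.instance Definition _ := [Choice of c0 by <:].
HB.instance Definition _ := [SubChoice_isSubLmodule of c0 by <:].

Local Notation abs u := (fun n => rnorm (val u n : K^o)).

Let c0_bounded (u : c0) : has_ubound (range (abs u)).
Proof.
have /cvg_seq_bounded : cvgn (val u : nat -> K^o).
  by apply/cvg_ex; exists 0; have := valP u; rewrite inE.
move=> [M [Mreal /(_ (M + 1))]].
rewrite ltrDl ltr01 => /(_ isT) uM.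
exists (real_part (M + 1)) => _ [n _ <-].
rewrite -(ler_of_real (k := k)) rnormK real_partK; first exact: uM.
exact: le_trans (uM 0%N I).
Qed.

Let norm (u : c0) : K := of_real k (sup (range (abs u))).

Let sup_ge (u : c0) n : abs u n <= sup (range (abs u)).
Proof. by apply: ub_le_sup; [exact: c0_bounded|exists n]. Qed.

Let sup_le (u : c0) M : (forall n, abs u n <= M) -> sup (range (abs u)) <= M.
Proof.
by move=> uM; apply: ge_sup; [exists (abs u 0%N), 0%N|move=> _ [n _ <-]].
Qed.

Let ler_normD u v : norm (u + v) <= norm u + norm v.
Proof.
rewrite /norm -of_realD ler_of_real; apply: sup_le => n.
by apply: le_trans (ler_rnormD _ _) _; apply: lerD; exact: sup_ge.
Qed.

Let normrZ (a : K) u : norm (a *: u) = `|a| * norm u.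
Proof.
rewrite /norm -(rnormK (a : K^o)) -of_realM; congr of_real.
apply/eqP; rewrite eq_le; apply/andP; split.
  apply: sup_le => n; rewrite [leLHS]rnormM.
  by apply: ler_wpM2l; [exact: rnorm_ge0|exact: sup_ge].
have [->|a0] := eqVneq a 0.
  by rewrite rnorm0 mul0r; apply: le_trans (sup_ge _ 0%N); exact: rnorm_ge0.
have ra0 : 0 < rnorm (a : K^o).
  rewrite lt0r rnorm_ge0 andbT; apply: contra_neq a0; exact: rnorm0_eq0.
rewrite mulrC -ler_pdivlMr//; apply: sup_le => n.
rewrite ler_pdivlMr// mulrC -[leLHS]rnormM.
exact: (sup_ge (a *: u)).
Qed.

Let normr0_eq0 u : norm u = 0 -> u = 0.
Proof.
rewrite /norm -(of_real0 (k := k)) => /(can_inj of_realK) u0.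
apply/val_inj/funext => n; apply: (@rnorm0_eq0 _ _ K^o).
by apply/eqP; rewrite eq_le rnorm_ge0 andbT -u0 sup_ge.
Qed.

HB.instance Definition _ :=
  Lmodule_isNormed.Build K c0 ler_normD normrZ normr0_eq0.

Lemma c0_normE (u : c0) :
  rnorm u = sup (range (fun n => rnorm (val u n : K^o))).
Proof. exact: of_realK. Qed.

End c0.

Section ell1.
Variables (R : realType) (k : scalar_kind).
Local Notation K := (scalars R k).
Local Notation abs u := (fun n => rnorm (u n : K^o)).

Definition ell1_pred : {pred nat -> K} :=
  [pred u | `[< cvgn (series (abs u)) >]].

Let ell1_submod : submod_closed ell1_pred.
Proof.
split=> [|a u v]; rewrite !inE.
  rewrite (_ : series _ = cst 0); first exact: is_cvg_cst.
  by apply/funext => n; rewrite /series /= big1// => i _; exact: rnorm0.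
move=> u1 v1.
have uv1 : cvgn (series (rnorm (a : K^o) *: abs u + abs v)).
  by apply: is_cvg_seriesD => //; exact: is_cvg_seriesZ.
apply: series_le_cvg uv1 => n; first exact: rnorm_ge0.
  by apply: addr_ge0; [apply: mulr_ge0|]; exact: rnorm_ge0.
by apply: le_trans (ler_rnormD _ _) _; rewrite [X in X + _]rnormM.
Qed.

HB.instance Definition _ := GRing.isSubmodClosed.Build K (nat -> K) ell1_pred
  ell1_submod.

Definition ell1 : Type := {u : nat -> K | u \in ell1_pred}.

HB.instance Definition _ := SubType.on ell1.
HB.instance Definition _ := [Choice of ell1 by <:].
HB.instance Definition _ := [SubChoice_isSubLmodule of ell1 by <:].

Let summable (u : ell1) : cvgn (series (abs (val u))).
Proof. by have := valP u; rewrite inE. Qed.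

Let norm (u : ell1) : K := of_real k (limn (series (abs (val u)))).

Let ler_normD u v : norm (u + v) <= norm u + norm v.
Proof.
rewrite /norm -of_realD ler_of_real -limD; [|exact: summable..].
apply: ler_lim; [exact: summable|by apply: is_cvgD; exact: summable|].
apply: nearW => n; rewrite -seriesD /series /=.
by apply: ler_sum => i _; exact: ler_rnormD.
Qed.

Let normrZ (a : K) u : norm (a *: u) = `|a| * norm u.
Proof.
rewrite /norm -(rnormK (a : K^o)) -of_realM; congr of_real.
rewrite -[RHS]/(_ *: (_ : R^o)) -lim_seriesZ; last exact: summable.
by congr (limn (series _)); apply/funext => n; exact: rnormM.
Qed.

Let normr0_eq0 u : norm u = 0 -> u = 0.
Proof.
rewrite /norm -(of_real0 (k := k)) => /(can_inj of_realK) u0.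
apply/val_inj/funext => n; apply: (@rnorm0_eq0 _ _ K^o).
apply/eqP; rewrite eq_le rnorm_ge0 andbT -u0.
have nd : nondecreasing_seq (series (abs (val u))).
  by apply: nondecreasing_series => i _ _; exact: rnorm_ge0.
apply: le_trans (nondecreasing_cvgn_le nd (@summable u) n.+1).
rewrite /series /= big_nat_recr//= lerDr.
by apply: sumr_ge0 => i _; exact: rnorm_ge0.
Qed.

HB.instance Definition _ :=
  Lmodule_isNormed.Build K ell1 ler_normD normrZ normr0_eq0.

Lemma ell1_normE (u : ell1) :
  rnorm u = limn (series (fun n => rnorm (val u n : K^o))).
Proof. exact: of_realK. Qed.

End ell1.

Definition separable (T : topologicalType) : Prop :=
  exists2 A : set T, countable A & dense A.

Section banach.
Context {R : realType} {k : scalar_kind}.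
Local Notation K := (scalars R k).

Definition weakly_null (X : normedModType K) (x_ : nat -> X) : Prop :=
  forall f : {linear X -> K^o}, continuous f -> f (x_ n) @[n --> \oo] --> 0.

Definition property_m_infty (X : normedModType K) : Prop :=
  forall (x : X) (x_ : nat -> X), weakly_null x_ ->
    limn_esup (fun n => (rnorm (x + x_ n))%:E) =
    maxe (rnorm x)%:E (limn_esup (fun n => (rnorm (x_ n))%:E)).

Definition isomorphism (X Y : normedModType K)
    (T : {linear X -> Y}) (T' : {linear Y -> X}) : Prop :=
  [/\ cancel T T', cancel T' T, continuous T & continuous T'].

Definition contains_copy (Y X : normedModType K) : Prop :=
  exists S : submodClosed X, closed [set` S] /\
    exists (T : {linear Y -> subspace_of S}) (T' : {linear subspace_of S -> Y}),
      isomorphism T T'.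

(* Real-valued, hence meaningful for bounded T only. *)
Definition opnorm (X Y : normedModType K) (T : {linear X -> Y}) : R :=
  sup [set rnorm (T x) | x in [set x | rnorm x <= 1]].

(* The value is +oo when X and Y are not isomorphic. *)
Definition banach_mazur (X Y : normedModType K) : \bar R :=
  ereal_inf [set d | exists (T : {linear X -> Y}) (T' : {linear Y -> X}),
    isomorphism T T' /\ d = (opnorm T * opnorm T')%:E].

End banach.

(* Main.v *)
(* A subspace of c0 has property (m_oo) because the norm of u + u_n is almost the
   maximum of the two norms once u_n is small on the finitely many coordinates
   where u is not small.

   Conversely, let X have (m_oo) and contain no copy of l1. A weakly Cauchy
   sequence x_n of the unit ball has far-out convex combinations v such that
   |x_n - v| <= 1 + e for all large n: if |x_n - v| <= A = 1 + s is achieved by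
   combinations v = v1, v2, ... then
     2 x_n - v1 - v2 = x_n - (v1 - (x_n - v2) / A) + (1 - 1/A) (x_n - v2),
   where (m_oo) bounds the bracket by 1 + e, so (v1 + v2) / 2 achieves
   1 + s/2 + e, and s can be iterated down to 0. As Rosenthal's theorem supplies
   weakly Cauchy subsequences, norming vectors of a weak*-null sequence z_n can
   then be replaced by weakly null ones, and (m_oo) dualizes to
     |f + z_n| >= |f| + |z_n| - e   for large n.
   So every f has a weak*-neighbourhood of functionals g with
   |f| + |g - f| <= |g| + e. By weak*-compactness finitely many f suffice.
   Iterating with ever smaller tolerances writes any g as a sum of elements of
   prescribed finite sets, almost additively in norm, up to a remainder which
   is small on a prescribed finite set of vectors; hence the normalized elements
   of these finite sets form a weak*-null sequence which is almost norming, that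
   is, an almost isometric embedding into c0. *)

From HB Require Import structures.
Require Import Defs.
From mathcomp Require Import all_boot all_order all_algebra.
From mathcomp Require Import all_classical all_reals all_analysis.
From mathcomp Require Import complex.
From mathcomp Require Import ring lra.

Set Implicit Arguments.
Unset Strict Implicit.
Unset Printing Implicit Defensive.

Import Order.TTheory GRing.Theory Num.Theory.
Import numFieldNormedType.Exports.

Local Open Scope classical_set_scope.
Local Open Scope ring_scope.

(** * Real-valued norms and moduli of scalars *)

Section rnorm_theory.
Context {R : realType} {k : scalar_kind}.
Local Notation K := (scalars R k).

Lemma ltr_of_real x y : (of_real k x < of_real k y :> K) = (x < y).
Proof. by case: k => //=; exact: ltcR. Qed.

Section normed.
Context {V : normedModType K}.
Implicit Types x y : V.

Lemma rnormZ (a : K) x : rnorm (a *: x) = rnorm a * rnorm x.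
Proof.
by apply: (can_inj (@of_realK R k)); rewrite of_realM !rnormK normrZ.
Qed.

Lemma rnormN x : rnorm (- x) = rnorm x.
Proof. by rewrite /rnorm normrN. Qed.

Lemma rnorm_distC x y : rnorm (x - y) = rnorm (y - x).
Proof. by rewrite /rnorm distrC. Qed.

Lemma ler_rnormB x y : rnorm (x - y) <= rnorm x + rnorm y.
Proof. by rewrite -(rnormN y) ler_rnormD. Qed.

Lemma rnorm_gt0 x : x != 0 -> 0 < rnorm x.
Proof.
by move=> x0; rewrite lt0r rnorm_ge0 andbT; apply: contra_neq x0; exact: rnorm0_eq0.
Qed.

Lemma ler_rnorm_sum I (r : seq I) (P : pred I) (F : I -> V) :
  rnorm (\sum_(i <- r | P i) F i) <= \sum_(i <- r | P i) rnorm (F i).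
Proof.
elim/big_ind2 : _ => //; first by rewrite rnorm0.
by move=> x a y b xa yb; apply: le_trans (ler_rnormD _ _) _; exact: lerD.
Qed.

Lemma ler_rnorm_dist x y : rnorm x - rnorm y <= rnorm (x - y).
Proof. by rewrite lerBlDr -{1}(subrK y x) ler_rnormD. Qed.

Lemma rnorm_lt x e : (rnorm x < e) = (`|x| < of_real k e).
Proof. by rewrite -rnormK ltr_of_real. Qed.

Lemma rnorm_cvgP (u : nat -> V) l : u n @[n --> \oo] --> l <->
  forall e : R, 0 < e -> \forall n \near \oo, rnorm (u n - l) <= e.
Proof.
split.
  move=> /cvgrPdist_lt ul e e0.
  have e0K : 0 < of_real k e :> K by rewrite -(of_real0 (R := R)) ltr_of_real.
  by apply: filterS (ul _ e0K) => n; rewrite distrC -rnorm_lt => /ltW.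
move=> ul; apply/cvgrPdist_le => e e0.
have e0R : 0 < real_part e.
  by rewrite -ltr_of_real real_partK ?ltW// of_real0.
apply: filterS (ul _ e0R) => n.
by move=> uln; rewrite distrC -(real_partK (ltW e0)) -rnormK ler_of_real.
Qed.

End normed.

Lemma rnorm_of_real r : rnorm (of_real k r : K) = `|r|.
Proof.
rewrite /rnorm; case: k => //=.
by rewrite expr0n addr0 sqrtr_sqr.
Qed.

Lemma rnorm1 : rnorm (1 : K) = 1.
Proof. by rewrite -(of_real1 (R := R)) rnorm_of_real normr1. Qed.

Lemma rnormV (a : K) : rnorm a^-1 = (rnorm a)^-1.
Proof.
have [->|a0] := eqVneq a 0; first by rewrite invr0 rnorm0 invr0.
have na : rnorm a != 0 by apply: contra_neq a0; exact: rnorm0_eq0.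
by apply: (mulfI na); rewrite -rnormM !divff// rnorm1.
Qed.

Lemma of_realB x y : of_real k (x - y) = of_real k x - of_real k y :> K.
Proof. by apply/eqP; rewrite eq_sym subr_eq -of_realD subrK. Qed.

Lemma of_realN x : of_real k (- x) = - of_real k x :> K.
Proof. by rewrite -sub0r of_realB of_real0 sub0r. Qed.

(** [mu] turns [b] onto the ray of [a], so that the two scalars add up without cancellation. *)
Lemma rnorm_align (a b : K) :
  exists mu : K, rnorm mu = 1 /\ rnorm (a + mu * b) = rnorm a + rnorm b.
Proof.
have [->|a0] := eqVneq a 0; first by exists 1; rewrite rnorm1 mul1r add0r rnorm0 add0r.
have [->|b0] := eqVneq b 0; first by exists 1; rewrite rnorm1 mulr0 addr0 rnorm0 addr0.
have na : rnorm a != 0 by apply: contra_neq a0; exact: rnorm0_eq0.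
have nb : rnorm b != 0 by apply: contra_neq b0; exact: rnorm0_eq0.
have nb0 : 0 <= rnorm b / rnorm a by rewrite divr_ge0 ?rnorm_ge0.
exists (of_real k (rnorm b / rnorm a) * a / b); split.
  by rewrite !rnormM rnorm_of_real rnormV ger0_norm// -mulrA mulrA divfK// divff.
rewrite mulfVK// -{1}(mul1r a) -mulrDl rnormM -(of_real1 (R := R)) -of_realD rnorm_of_real.
by rewrite ger0_norm ?addr_ge0// mulrDl mul1r divfK.
Qed.

End rnorm_theory.

(** * Real and imaginary parts, finite grids, Cauchy sequences *)

Section scalar_parts.
Context {R : realType} {k : scalar_kind}.
Local Notation K := (scalars R k).

Definition im_part : K -> R :=
  match k return scalars R k -> R with
  | RealScalars => fun=> 0
  | ComplexScalars => @complex.Im R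
  end.

(* Zero for real scalars, so that [scalar_partsE] covers both kinds. *)
Definition im_unit : K :=
  match k return scalars R k with
  | RealScalars => 0
  | ComplexScalars => Complex 0 1
  end.

Lemma scalar_partsE (z : K) :
  z = of_real k (real_part z) + im_unit * of_real k (im_part z).
Proof.
rewrite /of_real /real_part /im_part /im_unit; case: k z => [z|[a b]].
  by rewrite mul0r addr0.
by apply/eqP; rewrite eq_complex /= !(mul0r, mul1r, mulr0, addr0, add0r, subr0) !eqxx.
Qed.

Lemma real_partD (a b : K) : real_part (a + b) = real_part a + real_part b.
Proof. by rewrite /real_part; case: k a b => // -[a b] [c d]. Qed.

Lemma im_partD (a b : K) : im_part (a + b) = im_part a + im_part b.
Proof. by rewrite /im_part; case: k a b => [a b|[a b] [c d]]//; rewrite addr0. Qed.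

Lemma real_partN (a : K) : real_part (- a) = - real_part a.
Proof. by rewrite /real_part; case: k a => // -[a b]. Qed.

Lemma im_partN (a : K) : im_part (- a) = - im_part a.
Proof. by rewrite /im_part; case: k a => [a|[a b]]//; rewrite oppr0. Qed.

Lemma ler_real_part (a : K) : `|real_part a| <= rnorm a.
Proof.
rewrite /rnorm /real_part; case: k a => //= -[a b] /=.
by rewrite -sqrtr_sqr ler_wsqrtr// lerDl sqr_ge0.
Qed.

Lemma ler_im_part (a : K) : `|im_part a| <= rnorm a.
Proof.
rewrite /rnorm /real_part /im_part; case: k a => [a|[a b]] /=; first by rewrite normr0.
by rewrite -sqrtr_sqr ler_wsqrtr// lerDr sqr_ge0.
Qed.

Lemma rnorm_im_unit : rnorm im_unit <= 1.
Proof.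
rewrite /rnorm /real_part /im_unit; case: k => /=; first by rewrite normr0.
by rewrite expr0n/= add0r expr1n sqrtr1.
Qed.

Lemma ler_rnorm_parts (z : K) : rnorm z <= `|real_part z| + `|im_part z|.
Proof.
rewrite {1}(scalar_partsE z); apply: le_trans (ler_rnormD _ _) _.
rewrite rnormM !rnorm_of_real lerD2l -[leRHS]mul1r.
by apply: ler_wpM2r => //; exact: rnorm_im_unit.
Qed.

(** The signs are those of the real parts or those of the imaginary parts, whichever have the larger
    absolute sum; this costs the factor 2. *)
Lemma choose_signs n (c : nat -> K) : exists s : nat -> bool,
  \sum_(i < n) rnorm (c i) <= 2 * rnorm (\sum_(i < n) (-1) ^+ s i * c i).
Proof.
have sgn (p : K -> R) : (forall a b, p (a + b) = p a + p b) ->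
    (forall a, p (- a) = - p a) -> (forall a, `|p a| <= rnorm a) ->
    exists s : nat -> bool,
      \sum_(i < n) `|p (c i)| <= rnorm (\sum_(i < n) (-1) ^+ s i * c i).
  move=> pD pN ple; exists (fun i => p (c i) < 0).
  apply: le_trans (ple _); apply: le_trans (ler_norm _).
  have p0 : p 0 = 0 by apply: (addrI (p 0)); rewrite -pD !addr0.
  rewrite (big_morph p pD p0); apply: ler_sum => i _.
  case: ltrP => pc; first by rewrite expr1 mulN1r pN ltr0_norm.
  by rewrite expr0 mul1r ger0_norm.
have [s sP] := sgn _ real_partD real_partN ler_real_part.
have [t tP] := sgn _ im_partD im_partN ler_im_part.
have le2 : \sum_(i < n) rnorm (c i) <=
    \sum_(i < n) `|real_part (c i)| + \sum_(i < n) `|im_part (c i)|.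
  by rewrite -big_split; apply: ler_sum => i _; exact: ler_rnorm_parts.
set a := \sum_(i < n) `|real_part (c i)| in le2 sP.
set b := \sum_(i < n) `|im_part (c i)| in le2 tP.
have [ab|ba] := leP a b; [exists t|exists s]; lra.
Qed.

Lemma real_grid (r rho : R) : 0 < rho -> exists s : seq R,
  forall t, `|t| <= r -> exists2 a, a \in s & `|t - a| <= rho.
Proof.
move=> rho0.
exists [seq - r + i%:R * rho | i <- iota 0 (Num.truncn (2 * r / rho)).+1] => t.
rewrite ler_norml => /andP[rt tr].
have q0 : 0 <= (t + r) / rho by rewrite divr_ge0 ?(ltW rho0)//; lra.
exists (- r + (Num.truncn ((t + r) / rho))%:R * rho).
  apply/mapP; eexists; last by [].
  rewrite mem_iota add0n ltnS/=; apply: le_truncn.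
  by rewrite ler_pM2r ?invr_gt0//; lra.
have /andP[] := truncn_itv q0; set m := Num.truncn _.
rewrite ler_pdivlMr// ltr_pdivrMr// -natr1 mulrDl mul1r => h1 h2.
by rewrite ger0_norm; lra.
Qed.

Lemma scalar_grid (r rho : R) : 0 < rho -> exists s : seq K,
  forall t, rnorm t <= r -> exists2 a, a \in s & rnorm (t - a) <= rho.
Proof.
move=> rho0; have [s sP] := real_grid r (divr_gt0 rho0 (ltr0Sn R 1)).
exists [seq of_real k a + im_unit * of_real k b | a <- s, b <- s] => t tr.
have [a sa ta] := sP _ (le_trans (ler_real_part t) tr).
have [b sb tb] := sP _ (le_trans (ler_im_part t) tr).
exists (of_real k a + im_unit * of_real k b); first exact: allpairs_f.
rewrite {1}(scalar_partsE t) opprD addrACA -mulrBr -!of_realB.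
apply: le_trans (ler_rnormD _ _) _; rewrite rnormM !rnorm_of_real.
have : rnorm im_unit * `|im_part t - b| <= `|im_part t - b|.
  by apply: ler_piMl => //; exact: rnorm_im_unit.
by move: ta tb; set x := _ * `|_|; lra.
Qed.

Definition rcauchy (V : normedModType K) (u : nat -> V) :=
  forall e : R, 0 < e -> exists N, forall m n, (N <= m)%N -> (N <= n)%N ->
    rnorm (u m - u n) <= e.

Lemma rcauchy_cvg (V : completeNormedModType K) (u : nat -> V) :
  rcauchy u -> cvgn u.
Proof.
move=> cu; apply: cauchy_cvg; apply/cauchy_exP => e e0.
have e0R : 0 < real_part e.
  by rewrite -(ltr_of_real (k := k)) real_partK ?ltW// of_real0.
have [N uN] := cu _ (divr_gt0 e0R (ltr0Sn R 1)).
exists (u N); change (\forall n \near \oo, ball (u N) e (u n)); near=> n.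
rewrite -ball_normE /= -rnormK -(real_partK (ltW e0)) ltr_of_real.
apply: (@le_lt_trans _ _ (real_part e / 2)); last by lra.
have Nn : (N <= n)%N by near: n; exists N.
exact: (uN N n (leqnn N) Nn).
Unshelve. all: by end_near. Qed.

End scalar_parts.

(** Reduces to completeness of [R] through the two parts, so that real and complex scalars are
    treated alike. *)
Lemma scalar_rcauchy_cvg {R : realType} {k : scalar_kind} (u : nat -> (scalars R k)^o) :
  rcauchy u -> exists l : (scalars R k)^o, u n @[n --> \oo] --> l.
Proof.
move=> cu.
have parts (p : scalars R k -> R) : (forall a b, p (a + b) = p a + p b) ->
    (forall a, p (- a) = - p a) -> (forall a, `|p a| <= rnorm a) ->
    exists l, forall e : R, 0 < e -> \forall n \near \oo, `|p (u n) - l| <= e.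
  move=> pD pN ple.
  have : @rcauchy R RealScalars R^o (p \o u).
    move=> e /cu[N uN]; exists N => m n Nm Nn.
    by apply: le_trans (uN _ _ Nm Nn); rewrite /rnorm/= -pN -pD; exact: ple.
  move=> /(@rcauchy_cvg R RealScalars R^o)/cvg_ex[l] ul; exists l.
  exact/(@rnorm_cvgP R RealScalars R^o).
have [a aP] := parts _ real_partD real_partN ler_real_part.
have [b bP] := parts _ im_partD im_partN ler_im_part.
exists (of_real k a + im_unit * of_real k b); apply/rnorm_cvgP => e e0.
have e20 : 0 < e / 2 by lra.
near=> n; rewrite {1}(scalar_partsE (u n)) opprD addrACA -mulrBr -!of_realB.
apply: le_trans (ler_rnormD _ _) _; rewrite rnormM !rnorm_of_real.
have le1 : rnorm (@im_unit R k) * `|im_part (u n) - b| <= `|im_part (u n) - b|.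
  by apply: ler_piMl => //; exact: rnorm_im_unit.
rewrite (splitr e); apply: lerD; first by near: n; exact: aP.
by apply: le_trans le1 _; near: n; exact: bP.
Unshelve. all: by end_near. Qed.

(** * The Hahn-Banach theorem *)

Section sublinear.
Context {R : realType} {k : scalar_kind}.
Local Notation K := (scalars R k).
Context {V : lmodType K}.
Implicit Types (q p : V -> R) (x y : V) (t : R).

Local Notation "t .* x" := (of_real k t *: x) (at level 40).

(** Only nonnegative real scalars enter: a complex space is treated as a real one, and complex
    linearity is restored in [hahn_banach]. *)
Definition sublinear q :=
  (forall x y, q (x + y) <= q x + q y) /\
  (forall t x, 0 <= t -> q (t .* x) = t * q x).

Lemma sublinear0 q : sublinear q -> q 0 = 0.
Proof. by move=> [_ /(_ 0 0 (lexx 0))]; rewrite of_real0 scale0r mul0r. Qed.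

Lemma sublinear_opp q x : sublinear q -> - q (- x) <= q x.
Proof.
move=> qs; rewrite -subr_ge0 opprK -(sublinear0 qs) -(subrr x).
by case: qs.
Qed.

(** The reverse inequality in homogeneity is the given one for [t^-1] at [t .* x]. *)
Lemma sublinear_of_le q : q 0 = 0 -> (forall x y, q (x + y) <= q x + q y) ->
  (forall t x, 0 < t -> q (t .* x) <= t * q x) -> sublinear q.
Proof.
move=> q0 qD qZ; split=> // t x; rewrite le_eqVlt => /predU1P[<-|t0].
  by rewrite of_real0 scale0r mul0r.
apply/eqP; rewrite eq_le qZ//= -ler_pdivlMl//.
have := qZ t^-1 (t .* x); rewrite invr_gt0 => /(_ t0).
by rewrite scalerA -of_realM mulVf ?gt_eqF// of_real1 scale1r.
Qed.

Section reduction.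
Variables (q : V -> R) (y : V).
Hypothesis qs : sublinear q.

Let vals x := [set q (x + t .* y) - t * q y | t in [set t | 0 <= t]].

(* A sublinear minorant of [q]; if it equals [q], as it must when [q] is
   minimal, then [reduction_le] at [t = 1] makes [q] additive. *)
Definition reduction x := inf (vals x).

Let vals_lb x : lbound (vals x) (- q (- x)).
Proof.
move=> _ [t /= t0 <-]; have [qD qZ] := qs.
have := qD (x + t .* y) (- x); rewrite addrAC subrr add0r qZ//; lra.
Qed.

Lemma reduction_le x t : 0 <= t -> reduction x <= q (x + t .* y) - t * q y.
Proof. by move=> t0; apply: ge_inf; [eexists; exact: vals_lb|exists t]. Qed.

Let le_reduction x r :
  (forall t, 0 <= t -> r <= q (x + t .* y) - t * q y) -> r <= reduction x.
Proof.
move=> rP; apply: lb_le_inf; last by move=> _ [t t0 <-]; exact: rP.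
by eexists; exists 0 => /=.
Qed.

Lemma reduction_le0 x : reduction x <= q x.
Proof.
by have := reduction_le x (lexx 0); rewrite of_real0 scale0r addr0 mul0r subr0.
Qed.

Lemma reduction_sublinear : sublinear reduction.
Proof.
have [qD qZ] := qs.
apply: sublinear_of_le.
- apply/eqP; rewrite eq_le; apply/andP; split.
    by rewrite -[leRHS](sublinear0 qs) reduction_le0.
  by apply: le_reduction => t t0; rewrite add0r qZ// subrr.
(* A parameter [t] for [x] and a parameter [s] for [z] give the parameter [s + t] for [x + z]. *)
- move=> x z; rewrite -lerBlDr; apply: le_reduction => t t0.
  rewrite lerBlDr -lerBlDl; apply: le_reduction => s s0.
  rewrite lerBlDr; apply: le_trans (reduction_le _ (addr_ge0 s0 t0)) _.
  rewrite addrACA -opprD -mulrDl lerD2r of_realD scalerDl.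
  by rewrite (addrC x) addrACA qD.
- move=> t x t0; rewrite -ler_pdivrMl//; apply: le_reduction => s s0.
  rewrite ler_pdivrMl//.
  apply: le_trans (reduction_le _ (mulr_ge0 (ltW t0) s0)) _.
  by rewrite of_realM -scalerA -scalerDr qZ ?(ltW t0)// mulrBr mulrA.
Qed.

End reduction.

Lemma exists_minimal_sublinear p : sublinear p -> exists q, [/\ sublinear q,
  forall x, q x <= p x & forall r, sublinear r -> (forall x, r x <= q x) -> r = q].
Proof.
move=> ps; pose T := {q | sublinear q /\ forall x, q x <= p x}.
(* The order is reversed, so Zorn's maximal element is a minimal sublinear function. *)
pose le (s t : T) := `[< forall x, sval t x <= sval s x >].
have Tp : T by exists p.
have [|||A Atot|[q [qs qp]] qmin] := @Zorn T le.
- by move=> s; apply/asboolP.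
- by move=> t s u /asboolP st /asboolP tu; apply/asboolP => x; exact: le_trans (tu _) (st _).
- move=> [s sp] [t tp] /asboolP /= st /asboolP /= ts; apply: eq_exist; apply/funext => x.
  by apply/eqP; rewrite eq_le st ts.
- have [[a Aa]|A0] := pselect (exists a, A a); last first.
    by exists Tp => s As; exfalso; apply: A0; exists s.
  pose vals x := [set sval s x | s in A].
  (* A bound common to all sublinear minorants of [p] keeps the infimum over a chain finite. *)
  have lb x : lbound (vals x) (- p (- x)).
    move=> _ [[q [qs qp]] _ <-] /=; apply: le_trans (sublinear_opp _ qs).
    by rewrite lerN2 qp.
  pose r x := inf (vals x).
  have r_le s x : A s -> r x <= sval s x.
    by move=> As; apply: ge_inf; [eexists; exact: lb|exists s].
  have le_r x b : (forall s, A s -> b <= sval s x) -> b <= r x.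
    move=> bP; apply: lb_le_inf; first by exists (sval a x), a.
    by move=> _ [s As <-]; exact: bP.
  have rs : sublinear r.
    apply: sublinear_of_le.
    + apply/eqP; rewrite eq_le; apply/andP; split.
        by have := r_le _ 0 Aa; rewrite (sublinear0 (svalP a).1).
      by apply: (le_r) => s _; rewrite (sublinear0 (svalP s).1).
    + move=> x z; rewrite -lerBlDr; apply: (le_r) => s As.
      rewrite lerBlDr -lerBlDl; apply: (le_r) => t At; rewrite lerBlDl.
      (* The smaller of the two members of the chain serves at both vectors. *)
      have [/asboolP st|/asboolP ts] := Atot _ _ As At.
        apply: le_trans (r_le _ _ At) _; apply: le_trans ((svalP t).1.1 _ _) _.
        by rewrite lerD2r.
      apply: le_trans (r_le _ _ As) _; apply: le_trans ((svalP s).1.1 _ _) _.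
      by rewrite lerD2l.
    + move=> t x t0; rewrite -ler_pdivrMl//; apply: (le_r) => s As.
      rewrite ler_pdivrMl//.
      apply: le_trans (r_le _ _ As) _.
      by rewrite (svalP s).1.2 ?(ltW t0).
  have rp x : r x <= p x by apply: le_trans (r_le _ _ Aa) ((svalP a).2 x).
  exists (exist _ r (conj rs rp)) => s As; apply/asboolP => x /=; exact: r_le.
- exists q; split=> // r rs rq.
  have rp x : r x <= p x by apply: le_trans (rq x) (qp x).
  have := qmin (exist _ r (conj rs rp)) => /(_ _)/(congr1 sval)/= ->//.
  by apply/asboolP.
Qed.

Lemma minimal_sublinear_additive q : sublinear q ->
  (forall r, sublinear r -> (forall x, r x <= q x) -> r = q) ->
  forall x y, q (x + y) = q x + q y.
Proof.
move=> qs qmin x y; apply/eqP; rewrite eq_le qs.1/=.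
have /(congr1 (fun r => r x)) <- :=
  qmin _ (reduction_sublinear y qs) (reduction_le0 y qs).
rewrite -lerBrDr; apply: le_trans (reduction_le y qs x ler01) _.
by rewrite of_real1 scale1r mul1r.
Qed.

End sublinear.

Section functionals.
Context {R : realType} {k : scalar_kind}.
Local Notation K := (scalars R k).
Context {X : normedModType K}.

(** Functionals stay bare functions with linearity as a predicate: pointwise limits and combinations
    then need no packing into a structure. *)
Definition lfun (f : X -> K) := forall a x y, f (a *: x + y) = a * f x + f y.

Definition fbound (f : X -> K) (C : R) := forall x, rnorm (f x) <= C * rnorm x.

Definition dual_ball (C : R) : set (X -> K) := [set f | lfun f /\ fbound f C].

Lemma lfun0 f : lfun f -> f 0 = 0.
Proof.
move=> fl; have := fl 1 0 0; rewrite scale1r addr0 mul1r => e.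
by apply: (addrI (f 0)); rewrite addr0.
Qed.

Lemma lfunZ f a x : lfun f -> f (a *: x) = a * f x.
Proof. by move=> fl; rewrite -[X in f X]addr0 fl (lfun0 fl) addr0. Qed.

Lemma lfunD f x y : lfun f -> f (x + y) = f x + f y.
Proof. by move=> fl; rewrite -[X in f (X + _)]scale1r fl mul1r. Qed.

Lemma lfunN f x : lfun f -> f (- x) = - f x.
Proof. by move=> fl; rewrite -scaleN1r (lfunZ _ _ fl) mulN1r. Qed.

Lemma lfunB f x y : lfun f -> f (x - y) = f x - f y.
Proof. by move=> fl; rewrite (lfunD _ _ fl) (lfunN _ fl). Qed.

Lemma lfun_sum f I (r : seq I) (P : pred I) (F : I -> X) : lfun f ->
  f (\sum_(i <- r | P i) F i) = \sum_(i <- r | P i) f (F i).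
Proof.
move=> fl; apply: (big_morph f); last exact: lfun0.
by move=> x y; exact: lfunD.
Qed.

End functionals.

Lemma rnorm_sublinear {R : realType} {k : scalar_kind}
  (X : normedModType (scalars R k)) : sublinear (fun x : X => rnorm x).
Proof.
split=> [x y|t x t0]; first exact: ler_rnormD.
by rewrite rnormZ rnorm_of_real ger0_norm.
Qed.

(* A minimal sublinear [q] below the reduction of the norm along [x0] satisfies
   [q (- x0) <= - rnorm x0]. *)
Lemma exists_real_norming {R : realType} {k : scalar_kind}
    (X : normedModType (scalars R k)) (x0 : X) : exists q : X -> R,
  [/\ forall x y, q (x + y) = q x + q y,
      forall t x, q (of_real k t *: x) = t * q x,
      forall x, q x <= rnorm x & q x0 = rnorm x0].
Proof.
have ps := rnorm_sublinear X.
have [q [qs qp qmin]] := exists_minimal_sublinear (reduction_sublinear x0 ps).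
have qD := minimal_sublinear_additive qs qmin.
have qN x : q (- x) = - q x.
  by apply/eqP; rewrite -addr_eq0 -qD addNr (sublinear0 qs).
have qle x : q x <= rnorm x by apply: le_trans (qp x) (reduction_le0 _ ps _).
exists q; split=> //.
  move=> t x; have [t0|t0] := leP 0 t; first exact: qs.2.
  apply: oppr_inj; rewrite -mulNr -qs.2 ?oppr_ge0 1?ltW//.
  by rewrite of_realN scaleNr qN.
apply/eqP; rewrite eq_le qle/= -lerN2 -qN.
apply: le_trans (qp _) _; apply: le_trans (reduction_le _ ps _ ler01) _.
by rewrite of_real1 scale1r addNr (sublinear0 ps) mul1r sub0r.
Qed.

Lemma hahn_banach {R : realType} {k : scalar_kind}
    (X : normedModType (scalars R k)) (x0 : X) : exists f : X -> scalars R k,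
  [/\ lfun f, fbound f 1 & rnorm (f x0) = rnorm x0].
Proof.
have [q [qD qZ qle qx0]] := exists_real_norming x0.
suff [f [fl fq]] : exists f : X -> scalars R k,
    lfun f /\ forall x, real_part (f x) = q x.
  have fb : fbound f 1.
    move=> x; rewrite mul1r.
    have [->|fx0] := eqVneq (f x) 0; first by rewrite rnorm0 rnorm_ge0.
    (* [mu] rotates [f x] to its modulus, where the real part, hence [q], sees all of it. *)
    pose mu := of_real k (rnorm (f x)) / f x.
    have mu1 : rnorm mu = 1.
      rewrite rnormM rnorm_of_real rnormV ger0_norm ?rnorm_ge0// divff//.
      by apply: contra_neq fx0; exact: rnorm0_eq0.
    have := qle (mu *: x); rewrite -fq (lfunZ _ _ fl) divfK// of_realK.
    by rewrite rnormZ mu1 mul1r.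
  exists f; split=> //; apply/eqP; rewrite eq_le -{1}[leRHS]mul1r fb/=.
  rewrite -qx0 -fq; apply: le_trans (ler_real_part _); exact: ler_norm.
case: k X x0 q qD qZ qle qx0 => X x0 q qD qZ qle qx0.
  exists q; split => // a x y; by rewrite qD qZ.
have dec (a b : R) : Complex a b =
    of_real ComplexScalars a + 'i%C * of_real ComplexScalars b.
  exact: (@scalar_partsE R ComplexScalars (Complex a b)).
have ii : 'i%C * 'i%C = - 1 :> R[i].
  by apply/eqP; rewrite eq_complex /= !(mul0r, mulr0, mul1r, oppr0, sub0r, addr0) !eqxx.
have qi a b x : q (Complex a b *: x) = a * q x + b * q ('i%C *: x).
  by rewrite dec scalerDl qD mulrC -scalerA !qZ.
(* The only complex-linear functional with real part [q]. *)
exists (fun x => Complex (q x) (- q ('i%C *: x))); split=> //.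
move=> [a b] x y.
have ic : 'i%C * Complex a b = Complex (- b) a.
  by apply/eqP; rewrite eq_complex /= !(mul0r, mul1r, add0r, sub0r) !eqxx.
rewrite scalerDr !qD scalerA ic (qi a b x) (qi (- b) a x).
apply/eqP; rewrite eq_complex /=; apply/andP; split; apply/eqP; ring.
Qed.

(** * Rosenthal's l1 theorem *)

(** Subsequences are handled as infinite sets of indices, until [infin_enum] lists them. *)
Definition infin (M : set nat) := forall n, exists2 m, (n <= m)%N & M m.

Lemma infin_ge (M : set nat) b : infin M -> infin [set n | M n /\ (b <= n)%N].
Proof.
move=> Mi n; have [m nm Mm] := Mi (maxn n b).
exists m; first by apply: leq_trans nm; rewrite leq_maxl.
by split=> //; apply: leq_trans nm; rewrite leq_maxr.
Qed.

Lemma infinT : infin setT.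
Proof. by move=> n; exists n. Qed.

Lemma homo_ltn_ge (s : nat -> nat) : (forall n, s n < s n.+1)%N -> forall n, (n <= s n)%N.
Proof. by move=> sS; elim=> // n IH; exact: leq_ltn_trans (sS n). Qed.

Lemma homo_ltn_lt (s : nat -> nat) : (forall n, s n < s n.+1)%N ->
  {homo s : i j / (i < j)%N}.
Proof. by move=> sS; apply: homo_ltn => //; exact: ltn_trans. Qed.

Lemma choose_chain (T : Type) (P : T -> Prop) (Q : T -> T -> Prop) t0 : P t0 ->
  (forall t, P t -> exists t', P t' /\ Q t t') ->
  exists u : nat -> T, [/\ u 0%N = t0, forall n, P (u n) & forall n, Q (u n) (u n.+1)].
Proof.
move=> Pt0 PQ.
have next (t : {t | P t}) : {t' : {t | P t} | Q (sval t) (sval t')}.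
  by apply: cid; have [t' [Pt' Qt']] := PQ _ (svalP t); exists (exist _ t' Pt').
have [u [u0 uS]] := dependent_choice next (exist _ t0 Pt0).
exists (sval \o u); split=> [|n|n]/=; [by rewrite u0|exact: svalP|exact: uS].
Qed.

Lemma infin_enum (M : set nat) : infin M ->
  exists s : nat -> nat, (forall n, s n < s n.+1)%N /\ forall n, M (s n).
Proof.
move=> Mi; have [m0 _ Mm0] := Mi 0%N.
have [|s [_ sM sS]] := @choose_chain _ M (fun i j => (i < j)%N) m0 Mm0.
  by move=> n _; have [m nm Mm] := Mi n.+1; exists m.
by exists s.
Qed.

Lemma infin_range (s : nat -> nat) : (forall n, s n < s n.+1)%N ->
  infin (range s).
Proof. by move=> sS n; exists (s n); [exact: homo_ltn_ge|exists n]. Qed.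

(** Diagonal extraction: from stage [p] on all points are taken from the [p]-th refinement, so the
    final set is contained in it up to finitely many indices, and the first hypothesis transfers
    [Q p]. *)
Lemma diagonal_infin (Q : nat -> set nat -> Prop) :
  (forall p M N b, Q p M -> (forall n, (b <= n)%N -> N n -> M n) -> Q p N) ->
  (forall p M, infin M -> exists N, [/\ infin N, N `<=` M & Q p N]) ->
  forall M, infin M -> exists N, [/\ infin N, N `<=` M & forall p, Q p N].
Proof.
move=> Qh Qe M Mi.
(* A state consists of the stage, the last point taken and the current refinement. *)
pose P (t : nat * nat * set nat) := infin t.2 /\ t.2 `<=` M.
pose S (t t' : nat * nat * set nat) := [/\ t'.1.1 = t.1.1.+1, (t.1.2 < t'.1.2)%N,
  t'.2 `<=` t.2, t'.2 t'.1.2 & Q t.1.1 t'.2].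
have [|u [u0 uP uS]] := @choose_chain _ P S (0, 0, M)%N (conj Mi (@subset_refl _ M)).
  move=> [[p n] N] [/= Ni NM]; have [N' [N'i N'N QN']] := Qe p _ Ni.
  have [m nm N'm] := N'i n.+1; exists (p.+1, m, N'); split=> //.
  by split=> //=; exact: subset_trans NM.
have up n : (u n).1.1 = n.
  by elim: n => [|n IH]; [rewrite u0|have [-> _ _ _ _] := uS n; rewrite IH].
have usub i j : (i <= j)%N -> (u j).2 `<=` (u i).2.
  move/subnK <-; elim: (j - i)%N => // d IH.
  by apply: subset_trans IH; have [] := uS (d + i)%N.
pose s n := (u n.+1).1.2.
have sS n : (s n < s n.+1)%N by have [] := uS n.+1.
exists (range s); split; first exact: infin_range.
  by move=> _ [n _ <-]; apply: (uP n.+1).2; have [] := uS n.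
move=> p; apply: (Qh p (u p.+1).2 _ (s p)).
  by have [_ _ _ _] := uS p; rewrite up.
move=> m + [n _ e]; rewrite -{m}e leqNgt => spn.
have pn : (p <= n)%N.
  by rewrite leqNgt; apply: contra spn => np; exact: homo_ltn_lt.
by apply: (@usub p.+1 n.+1) => //; have [] := uS n.
Qed.

Section independence.
Context {T : Type}.
Variables A B : nat -> set T.

Definition io (M : set nat) (P : set nat) := infin (M `&` P).

(* When [A n] and [B n] mean that the n-th term is near one of two distinct
   values, this says that no subsequence of [M] converges on all of [C]. *)
Definition rich (C : set T) (M : set nat) := forall N, infin N -> N `<=` M ->
  exists x, [/\ C x, io N [set n | A n x] & io N [set n | B n x]].

Lemma rich_sub C M N : rich C M -> N `<=` M -> rich C N.
Proof. by move=> CM NM L Li LN; apply: CM => //; exact: subset_trans NM. Qed.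

(* Otherwise one picks n_0 < n_1 < ... and M > N_0 > N_1 > ... such that no point
   of [C `&` D n_i] is infinitely often in both [A] and [B] along [N_i]; the
   sequence n_i then contradicts the richness of [C]. *)
Lemma rich_step (D : nat -> set T) C M : D = A \/ D = B -> infin M -> rich C M ->
  exists N, [/\ infin N, N `<=` M & forall n, N n -> rich (C `&` D n) N].
Proof.
move=> DAB Mi CM; apply: contrapT => noN.
have bad N b : infin N -> N `<=` M -> exists n N',
  [/\ N n, (b <= n)%N, infin N', N' `<=` N &
    forall x, C x -> D n x -> ~ (io N' [set n | A n x] /\ io N' [set n | B n x])].
  move=> Ni NM; apply: contrapT => nobad; apply: noN.
  exists [set n | N n /\ (b <= n)%N]; split; first exact: infin_ge.
    by move=> n [/NM].
  move=> n [Nn bn] L Li LN; apply: contrapT => nox; apply: nobad.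
  exists n, L; split=> //; first by move=> m /LN[].
  by move=> x Cx Dx [Ax Bx]; apply: nox; exists x.
pose P (t : nat * set nat) := infin t.2 /\ t.2 `<=` M.
pose S (t t' : nat * set nat) := [/\ (t.1 < t'.1)%N, t'.2 `<=` t.2, t.2 t'.1 &
  forall x, C x -> D t'.1 x ->
    ~ (io t'.2 [set n | A n x] /\ io t'.2 [set n | B n x])].
have [|u [u0 uP uS]] := @choose_chain _ P S (0%N, M) (conj Mi (@subset_refl _ M)).
  move=> [n N] [/= Ni NM]; have [m [N' [Nm nm N'i N'N N'P]]] := bad _ n.+1 Ni NM.
  by exists (m, N'); split=> //; split=> //=; exact: subset_trans NM.
have usub i j : (i <= j)%N -> (u j).2 `<=` (u i).2.
  move/subnK <-; elim: (j - i)%N => // d IH.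
  by apply: subset_trans IH; have [] := uS (d + i)%N.
pose s n := (u n.+1).1.
have sS n : (s n < s n.+1)%N by have [] := uS n.+1.
have sM : range s `<=` M.
  by move=> _ [n _ <-]; apply: (uP n).2; have [] := uS n.
have [x [Cx Ax Bx]] := CM _ (infin_range sS) sM.
have [n Dx] : exists n, D (s n) x.
  have : io (range s) [set n | D n x] by case: DAB => ->.
  by move=> /(_ 0%N)[m _ [[n _ <-] Dm]]; exists n.
(* The indices [s j] with [n < j] all lie in the refinement made for [s n]. *)
have tail E : io (range s) E -> io (u n.+1).2 E.
  move=> sE m; have [l ml [[j _ jl] El]] := sE (maxn m (s n.+1)).
  exists l; first by apply: leq_trans ml; rewrite leq_maxl.
  split=> //; rewrite -jl.
  have nj : (n < j)%N.
    rewrite ltnNge; apply/negP => jn.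
    have : (s n.+1 <= s j)%N by rewrite jl; apply: leq_trans ml; rewrite leq_maxr.
    by rewrite leqNgt => /negP; apply; exact: homo_ltn_lt.
  by apply: (usub n.+1 j) => //; have [] := uS j.
by have [_ _ _ /(_ x Cx Dx)] := uS n; apply; split; exact: tail.
Qed.

(** Splits all cells of one generation at once: each is refined first for [A], then for [B], and
    richness survives the later refinements. *)
Lemma rich_step_seq (I : eqType) (L : seq I) (C : I -> set T) M : infin M ->
  (forall i, i \in L -> rich (C i) M) ->
  exists N, [/\ infin N, N `<=` M & forall i n, i \in L -> N n ->
    rich (C i `&` A n) N /\ rich (C i `&` B n) N].
Proof.
elim: L M => [|i L IH] M Mi CM; first by exists M; split.
have [|N1 [N1i N1M N1P]] := IH _ Mi.
  by move=> j jL; apply: CM; rewrite inE jL orbT.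
have [|N2 [N2i N21 N2P]] := rich_step (or_introl erefl) N1i (C := C i).
  by apply: rich_sub N1M; apply: CM; rewrite inE eqxx.
have [|N3 [N3i N32 N3P]] := rich_step (or_intror erefl) N2i (C := C i).
  apply: rich_sub N21; apply: rich_sub N1M; apply: CM; rewrite inE eqxx//.
exists N3; split=> //; first by move=> n /N32/N21/N1M.
move=> j n; rewrite inE => /predU1P[->|jL] Nn.
  split; last exact: N3P.
  exact: rich_sub (N2P _ (N32 _ Nn)) N32.
have [N1A N1B] := N1P j n jL (N21 _ (N32 _ Nn)).
by split; [apply: rich_sub N1A _|apply: rich_sub N1B _] => m /N32/N21.
Qed.

(** Both lists run from the newest index to the oldest; unmatched entries impose no condition. *)
Fixpoint pattern (l : seq nat) (s : bitseq) : set T :=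
  match l, s with
  | n :: l', b :: s' => pattern l' s' `&` (if b then A n else B n)
  | _, _ => setT
  end.

(** A binary tree of cells is grown, one index per generation, with every cell kept rich; a rich
    cell is nonempty, and a point of it realizes the sign pattern. *)
Lemma rich_independent C M : infin M -> rich C M ->
  exists s : nat -> nat, (forall n, s n < s n.+1)%N /\
    forall m (b : nat -> bool), exists2 x, C x &
      forall i, (i < m)%N -> (if b i then A (s i) else B (s i)) x.
Proof.
move=> Mi CM.
(* [t.1] lists the indices used so far and [t.2] those still available; the last clause makes the
   enumeration increasing. *)
pose P (t : seq nat * set nat) := [/\ infin t.2,
  forall b, size b = size t.1 -> rich (C `&` pattern t.1 b) t.2 &
  forall n i, t.2 n -> i \in t.1 -> (i < n)%N].
pose S (t t' : seq nat * set nat) := exists2 n, t.2 n & t'.1 = n :: t.1.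
have [||u [u0 uP uS]] := @choose_chain _ P S ([::], M).
- split=> // -[]// _; rewrite (_ : _ `&` _ = C)//.
  by apply/seteqP; split => x /= => [[]|].
- move=> [l N] [/= Ni NP Nl].
  have [|N' [N'i N'N N'P]] := @rich_step_seq _
      [seq val t | t <- enum {: (size l).-tuple bool}]
      (fun b => C `&` pattern l b) _ Ni.
    by move=> _ /mapP[b _ ->]; apply: NP; rewrite size_tuple.
  have [n _ N'n] := N'i 0%N.
  exists (n :: l, [set m | N' m /\ (n.+1 <= m)%N]); split; last by exists n => //; exact: N'N.
  split=> /=; first exact: infin_ge.
    case=> // b s [sl].
    have sL : s \in [seq val t | t <- enum {: (size l).-tuple bool}].
      by apply/mapP; exists (Tuple (introT eqP sl)); rewrite ?mem_enum.
    rewrite setIA; apply: (@rich_sub _ N'); last by move=> m [].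
    by have [] := N'P _ _ sL N'n; case: b.
  move=> m i [N'm nm]; rewrite inE => /predU1P[->//|il].
  by apply: Nl il; exact: N'N.
pose s n := head 0%N (u n.+1).1.
have us n : (u n.+1).1 = s n :: (u n).1.
  by rewrite /s; have [m _ ->] := uS n.
exists s; split.
  move=> n; have [_ _ /(_ (s n.+1) (s n))] := uP n.+1; apply.
    by have [m um e] := uS n.+1; rewrite /s e.
  by rewrite us inE eqxx.
move=> m b.
(* The signs are listed newest first, to match [pattern]. *)
pose bits := fix bits m := if m is m'.+1 then b m' :: bits m' else [::].
have szu n : size (u n).1 = n by elim: n => [|n IH]; rewrite ?u0// us/= IH.
have szb n : size (bits n) = n by elim: n => //= n ->.
have [ui /(_ (bits m)) + _] := uP m; rewrite szu szb => /(_ erefl)/(_ _ ui (@subset_refl _ _)).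
move=> [x [[Cx xm] _ _]]; exists x => //.
elim: m {ui} xm => // m IH; rewrite us/= => -[/IH xm xs] i.
by rewrite ltnS leq_eqVlt => /predU1P[->|/xm//]; move: xs; case: (b m).
Qed.

End independence.

(** The pigeonhole principle, in the form that finds a grid point approached infinitely often. *)
Lemma eventually_avoid (N : set nat) n (P : nat -> set nat) :
  (forall j, (j < n)%N -> ~ io N (P j)) -> exists b, forall m j,
    N m -> (b <= m)%N -> (j < n)%N -> ~ P j m.
Proof.
elim: n => [|n IH] nP; first by exists 0%N.
have [b bP] := IH (fun j jn => nP j (ltnW jn)).
have [c cP] : exists c, forall m, N m -> (c <= m)%N -> ~ P n m.
  apply: contrapT => noc; apply: (nP n (ltnSn n)) => c.
  apply: contrapT => nom; apply: noc; exists c => m Nm cm Pm.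
  by apply: nom; exists m.
exists (maxn b c) => m j Nm; rewrite geq_max => /andP[bm cm].
rewrite ltnS leq_eqVlt => /predU1P[->|jn]; first exact: cP.
exact: bP.
Qed.

Section rosenthal.
Context {R : realType} {k : scalar_kind}.
Local Notation K := (scalars R k).
Context {X : normedModType K}.

Definition wcauchy (x : nat -> X) := forall f : X -> K, lfun f -> fbound f 1 ->
  rcauchy (f \o x : nat -> K^o).

(** For a bounded sequence this is equivalence to the unit vector basis of [ell1]. *)
Definition ell1_minorant (x : nat -> X) := exists2 d : R, 0 < d &
  forall n (c : nat -> K),
    d * \sum_(i < n) rnorm (c i) <= rnorm (\sum_(i < n) c i *: x i).

Let near_val (x : nat -> X) (c : K) (rho : R) n : set (X -> K) :=
  [set f | rnorm (f (x n) - c) <= rho].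

(* Tested on f - g, where f and g realize opposite sign patterns. *)
Lemma independent_ell1_minorant (x : nat -> X) (a b : K) (rho : R) :
  0 < rho -> 10 * rho <= rnorm (a - b) ->
  (forall n (s : nat -> bool), exists2 f, dual_ball 1 f & forall i, (i < n)%N ->
    (if s i then near_val x a rho i else near_val x b rho i) f) ->
  ell1_minorant x.
Proof.
move=> rho0 sep indep; exists rho => // n c.
have [s sP] := choose_signs n c.
have [f [fl fb] fP] := indep n s.
have [g [gl gb] gP] := indep n (fun i => ~~ s i).
set S := \sum_(i < n) rnorm (c i) in sP *.
set y := \sum_(i < n) c i *: x i.
(* The deviation of [f (x i) - g (x i)] from its ideal value, [a - b] or [b - a]. *)
pose e i := f (x i) - g (x i) - (-1) ^+ s i * (b - a).
have eP (i : 'I_n) : rnorm (e i) <= 2 * rho.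
  have := fP i (ltn_ord i); have := gP i (ltn_ord i); rewrite /e/=.
  case: (s i) => /= hg hf.
    rewrite expr1 mulN1r opprB [_ - (a - b)](_ : _ = (f (x i) - a) - (g (x i) - b)).
      by apply: le_trans (ler_rnormB _ _) _; move: hf hg; rewrite /near_val/=; lra.
    by ring.
  rewrite expr0 mul1r [_ - (b - a)](_ : _ = (f (x i) - b) - (g (x i) - a)).
    by apply: le_trans (ler_rnormB _ _) _; move: hf hg; rewrite /near_val/=; lra.
  by ring.
have yE : f y - g y =
    (b - a) * (\sum_(i < n) (-1) ^+ s i * c i) + \sum_(i < n) c i * e i.
  rewrite /y (lfun_sum _ _ _ fl) (lfun_sum _ _ _ gl) -sumrB mulr_sumr.
  rewrite -big_split/=; apply: eq_bigr => i _.
  by rewrite (lfunZ _ _ fl) (lfunZ _ _ gl) /e; ring.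
have err : rnorm (\sum_(i < n) c i * e i) <= 2 * rho * S.
  apply: le_trans (@ler_rnorm_sum _ _ K^o _ _ _ _) _.
  rewrite mulr_sumr; apply: ler_sum => i _.
  by rewrite rnormM mulrC; apply: ler_wpM2r (eP i); exact: rnorm_ge0.
have low : rnorm ((b - a) * (\sum_(i < n) (-1) ^+ s i * c i)) <=
    rnorm (f y - g y) + 2 * rho * S.
  have -> : (b - a) * (\sum_(i < n) (-1) ^+ s i * c i) =
    (f y - g y) - \sum_(i < n) c i * e i by rewrite yE addrK.
  by apply: le_trans (@ler_rnormB _ _ K^o _ _) _; rewrite lerD2l.
have up : rnorm (f y - g y) <= 2 * rnorm y.
  apply: le_trans (@ler_rnormB _ _ K^o _ _) _.
  by have := fb y; have := gb y; lra.
have S0 : 0 <= S by apply: sumr_ge0 => i _; exact: rnorm_ge0.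
have big : 10 * rho * (S / 2) <= rnorm ((b - a) * (\sum_(i < n) (-1) ^+ s i * c i)).
  rewrite rnormM; apply: ler_pM; [lra|lra| |lra].
  by rewrite (@rnorm_distC _ _ K^o).
(* Together, [5 * rho * S <= 2 * rnorm y + 2 * rho * S]. *)
nra.
Qed.

(** Either some pair of separated values is rich along a subsequence, which gives independence and
    hence the lower estimate, or every pair can be destroyed by passing to a subsequence, and a
    diagonal one is weakly Cauchy. *)
Lemma rosenthal (x : nat -> X) : (forall n, rnorm (x n) <= 1) ->
  exists s : nat -> nat, (forall n, s n < s n.+1)%N /\
    (ell1_minorant (x \o s) \/ wcauchy (x \o s)).
Proof.
move=> x1.
have [[a [b [rho [M [rho0 sep Mi Mrich]]]]]|norich] :=
  pselect (exists a b rho M, [/\ 0 < rho, 10 * rho <= rnorm (a - b), infin M &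
    rich (near_val x a rho) (near_val x b rho) (dual_ball 1) M]).
  have [s [sS sP]] := rich_independent Mi Mrich.
  by exists s; split=> //; left; exact: independent_ell1_minorant (sP).
pose rho m : R := m.+1%:R^-1.
have rho0 m : 0 < rho m by rewrite invr_gt0.
have [grid gridP] := choice (fun m => scalar_grid (k := k) 1 (rho0 m)).
(* Stage [p] treats one precision and one pair of grid points, so the diagonal set treats all of
   them. *)
pose Q (p : nat) (N : set nat) := forall m i j, unpickle p = Some (m, i, j) ->
  10 * rho m <= rnorm ((grid m)`_i - (grid m)`_j) -> forall f, dual_ball 1 f ->
  ~ (io N [set n | near_val x (grid m)`_i (rho m) n f] /\
     io N [set n | near_val x (grid m)`_j (rho m) n f]).
have [||N [Ni _ NQ]] := @diagonal_infin Q _ _ setT infinT.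
- move=> p M N c QM NM m i j pE sep f df [Ai Bi].
  have io_sub E : io N E -> io M E.
    move=> NE n; have [l nl [Nl El]] := NE (maxn n c).
    exists l; first by apply: leq_trans nl; rewrite leq_maxl.
    by split=> //; apply: NM => //; apply: leq_trans nl; rewrite leq_maxr.
  by apply: (QM m i j pE sep f df); split; exact: io_sub.
- move=> p M Mi; case pE : (unpickle p : option (nat * nat * nat)) => [[[m i] j]|]; last first.
    by exists M; split=> // m i j; rewrite pE.
  have [sep|nsep] := leP (10 * rho m) (rnorm ((grid m)`_i - (grid m)`_j)); last first.
    exists M; split=> // m' i' j'; rewrite pE => -[<- <- <-].
    by rewrite leNgt nsep.
  (* If no refinement worked, [M] would be rich for this pair. *)
  have := norich; apply: contra_notP => noN.
  exists (grid m)`_i, (grid m)`_j, (rho m), M; split=> //.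
  move=> N Ni NM; apply: contrapT => nof; apply: noN; exists N; split=> //.
  move=> m' i' j'; rewrite pE => -[<- <- <-] _ f df [Ai Bi].
  by apply: nof; exists f.
have [s [sS sN]] := infin_enum Ni.
exists s; split=> //; right => f fl fb e e0.
(* [22] is twice the radius [11 * rho m] of [close]. *)
have [m me] : exists m, 22 * rho m <= e.
  exists (Num.truncn (22 / e)); rewrite ler_pdivrMr// mulrC -ler_pdivrMr//.
  by rewrite ltW// truncnS_gt.
have fx1 n : rnorm (f (x n)) <= 1.
  by apply: le_trans (fb _) _; rewrite mul1r.
(* Once one grid point is approached infinitely often, those at distance at least [10 * rho m] from
   it are approached only finitely often, so the values end up within [11 * rho m] of it. *)
have [i [im iio]] : exists i, (i < size (grid m))%N /\
    io N [set n | near_val x (grid m)`_i (rho m) n f].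
  apply: contrapT => noi.
  have [j jm jio|b bP] := @eventually_avoid N (size (grid m))
      (fun j => [set n | near_val x (grid m)`_j (rho m) n f]).
    by apply: noi; exists j.
  have [n bn Nn] := Ni b; have [a ag ax] := gridP m _ (fx1 n).
  by apply: (bP n (index a (grid m)) Nn bn); rewrite ?index_mem//= /near_val/= nth_index.
have : exists n0, forall n j, N n -> (n0 <= n)%N -> (j < size (grid m))%N ->
    10 * rho m <= rnorm ((grid m)`_i - (grid m)`_j) ->
    ~ near_val x (grid m)`_j (rho m) n f.
  have [j jm jio|b bP] := @eventually_avoid N (size (grid m)) (fun j =>
      [set n | 10 * rho m <= rnorm ((grid m)`_i - (grid m)`_j) /\
               near_val x (grid m)`_j (rho m) n f]).
    have [n _ [_ [sep _]]] := jio 0%N.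
    have := NQ (pickle (m, i, j)) m i j (pickleK _) sep f (conj fl fb); apply.
    split=> // l; have [r lr [Nr [_ xr]]] := jio l.
    by exists r.
  by exists b => n j Nn bn jm sep xj; exact: (bP n j Nn bn jm (conj sep xj)).
move=> [n0 n0P].
have close n : N n -> (n0 <= n)%N -> rnorm (f (x n) - (grid m)`_i) <= 11 * rho m.
  move=> Nn n0n; have [a ag ax] := gridP m _ (fx1 n).
  have [sep|/ltW nsep] := leP (10 * rho m) (rnorm ((grid m)`_i - a)).
    exfalso; apply: (n0P n (index a (grid m))) => //; rewrite ?index_mem ?nth_index//.
  have -> : f (x n) - (grid m)`_i = (f (x n) - a) - ((grid m)`_i - a) by ring.
  by apply: le_trans (@ler_rnormB _ _ K^o _ _) _; lra.
exists n0 => p q n0p n0q /=.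
have -> : f (x (s p)) - f (x (s q)) =
  (f (x (s p)) - (grid m)`_i) - (f (x (s q)) - (grid m)`_i) by ring.
apply: le_trans (@ler_rnormB _ _ K^o _ _) _.
have sge r : (n0 <= r)%N -> (n0 <= s r)%N.
  by move=> n0r; apply: leq_trans n0r _; exact: homo_ltn_ge.
have := close _ (sN p) (sge _ n0p); have := close _ (sN q) (sge _ n0q); lra.
Qed.

End rosenthal.

(** * Bounded operators and isomorphisms onto their ranges *)

Section bounded_linear.
Context {R : realType} {k : scalar_kind}.
Local Notation K := (scalars R k).
Context {U V : normedModType K}.

Lemma rnorm_bound_continuous (T : {linear U -> V}) (a : R) :
  (forall x, rnorm (T x) <= a * rnorm x) -> continuous T.
Proof.
move=> Ta x; apply/cvgrPdist_le => e e0.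
have e0R : 0 < real_part e.
  by rewrite -(ltr_of_real (k := k)) real_partK ?ltW// of_real0.
pose b := Num.max a 1.
have b0 : 0 < b by rewrite lt_max ltr01 orbT.
have d0 : 0 < of_real k (real_part e / b) :> K.
  by rewrite -(of_real0 (R := R)) ltr_of_real divr_gt0.
near=> y.
rewrite -linearB -(real_partK (ltW e0)) -rnormK ler_of_real.
apply: le_trans (Ta _) _; apply: (@le_trans _ _ (b * rnorm (x - y))).
  by apply: ler_wpM2r; [exact: rnorm_ge0|rewrite le_max lexx].
rewrite mulrC -ler_pdivlMr//; apply/ltW; rewrite rnorm_lt.
by near: y; exact: cvgr_dist_lt.
Unshelve. all: by end_near. Qed.

Lemma continuous_rnorm_bound (T : {linear U -> V}) : continuous T ->
  exists2 a : R, 0 < a & forall x, rnorm (T x) <= a * rnorm x.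
Proof.
move=> Tc; have /linear_boundedP/pinfty_ex_gt0[M M0 MP] :=
  (linear_bounded_continuous T).2 Tc.
exists (real_part M); first by rewrite -(ltr_of_real (k := k)) real_partK ?ltW// of_real0.
move=> x; rewrite -(ler_of_real (k := k)) of_realM !rnormK (real_partK (ltW M0)).
exact: MP.
Qed.

Lemma opnorm_le (T : {linear U -> V}) (a : R) : 0 <= a ->
  (forall x, rnorm (T x) <= a * rnorm x) -> opnorm T <= a.
Proof.
move=> a0 Ta; apply: ge_sup.
  by exists (rnorm (T 0)), 0 => //=; rewrite rnorm0.
move=> _ [x /= x1 <-]; apply: le_trans (Ta x) _.
by rewrite -[leRHS]mulr1; apply: ler_wpM2l.
Qed.

Lemma opnorm_bound (T : {linear U -> V}) : continuous T ->
  forall x, rnorm (T x) <= opnorm T * rnorm x.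
Proof.
move=> /continuous_rnorm_bound[a a0 Ta] x.
have [->|x0] := eqVneq x 0; first by rewrite linear0 !rnorm0 mulr0.
have nx := rnorm_gt0 x0.
rewrite -ler_pdivrMr// mulrC -[(rnorm x)^-1]ger0_norm ?invr_ge0 ?(ltW nx)//.
rewrite -(rnorm_of_real (k := k)) -rnormZ -linearZ; rewrite /opnorm; apply: ub_le_sup.
  exists a => _ [y /= y1 <-]; apply: le_trans (Ta y) _.
  by rewrite -[leRHS]mulr1; apply: ler_wpM2l => //; exact: ltW.
exists (of_real k (rnorm x)^-1 *: x) => //=.
by rewrite rnormZ rnorm_of_real ger0_norm ?invr_ge0 ?(ltW nx)// mulVf ?gt_eqF.
Qed.

Lemma opnorm_ge0 (T : {linear U -> V}) : continuous T -> 0 <= opnorm T.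
Proof.
move=> /continuous_rnorm_bound[a a0 Ta].
rewrite -(rnorm0 (V := V)) -(linear0 T); rewrite /opnorm; apply: ub_le_sup.
  exists a => _ [y /= y1 <-]; apply: le_trans (Ta y) _.
  by rewrite -[leRHS]mulr1; apply: ler_wpM2l => //; exact: ltW.
by exists 0 => //=; rewrite rnorm0.
Qed.

End bounded_linear.

Section range.
Context {R : realType} {k : scalar_kind}.
Local Notation K := (scalars R k).
Context {U V : normedModType K}.

Definition limage (T : {linear U -> V}) : {pred V} :=
  [pred v | `[< exists u, T u = v >]].

Lemma limage_submod (T : {linear U -> V}) : submod_closed (limage T).
Proof.
split=> [|a u v]; rewrite !inE; first by exists 0; rewrite linear0.
by move=> [x <-] [y <-]; exists (a *: x + y); rewrite linearP.
Qed.

HB.instance Definition _ (T : {linear U -> V}) :=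
  GRing.isSubmodClosed.Build K V (limage T) (limage_submod T).

Lemma limage_isomorphism (T : {linear U -> V}) (a b : R) : 0 <= a -> 0 <= b ->
  (forall x, rnorm (T x) <= a * rnorm x) ->
  (forall x, rnorm x <= b * rnorm (T x)) ->
  exists (T1 : {linear U -> subspace_of (limage T)})
         (T2 : {linear subspace_of (limage T) -> U}),
    [/\ isomorphism T1 T2, opnorm T1 <= a & opnorm T2 <= b].
Proof.
move=> a0 b0 Ta Tb.
have T_img x : T x \in limage T by rewrite inE; exists x.
pose f x : subspace_of (limage T) := exist _ (T x) (T_img x).
have fl : linear f by move=> c x y; apply: val_inj; rewrite /= linearP.
have Tinj : injective T.
  move=> x y xy; apply/eqP; rewrite -subr_eq0; apply/eqP/rnorm0_eq0/eqP.
  rewrite eq_le rnorm_ge0 andbT; apply: le_trans (Tb _) _.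
  by rewrite linearB xy subrr rnorm0 mulr0.
have ex (v : subspace_of (limage T)) : exists u, T u = val v.
  by have := valP v; rewrite inE.
(* The inverse is obtained by choice; injectivity of [T] makes it linear. *)
pose g v := sval (cid (ex v)).
have gK v : T (g v) = val v by rewrite /g; case: cid.
have gl : linear g by move=> c x y; apply: Tinj; rewrite linearP !gK.
pose T1 : {linear U -> subspace_of (limage T)} := HB.pack f
  (GRing.isLinear.Build K U (subspace_of (limage T)) *:%R f fl).
pose T2 : {linear subspace_of (limage T) -> U} := HB.pack g
  (GRing.isLinear.Build K (subspace_of (limage T)) U *:%R g gl).
have T1a x : rnorm (T1 x) <= a * rnorm x by exact: Ta.
have T2b x : rnorm (T2 x) <= b * rnorm x.
  by apply: le_trans (Tb _) _; rewrite /= gK.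
exists T1, T2; split.
- split.
  + by move=> x; apply: Tinj; rewrite /= gK.
  + by move=> v; apply: val_inj; rewrite /= gK.
  + exact: (rnorm_bound_continuous T1a).
  + exact: (rnorm_bound_continuous T2b).
- exact: opnorm_le.
- exact: opnorm_le.
Qed.

End range.

Section closed_range.
Context {R : realType} {k : scalar_kind}.
Local Notation K := (scalars R k).

Lemma closure_seq (V : normedModType K) (A : set V) v : closure A v ->
  forall e : R, 0 < e -> exists2 a, A a & rnorm (a - v) <= e.
Proof.
move=> Av e e0.
have e0K : 0 < of_real k e :> K by rewrite -(of_real0 (R := R)) ltr_of_real.
have [a [Aa]] := Av _ (nbhsx_ballx v _ e0K).
rewrite -ball_normE /= -rnorm_lt rnorm_distC => /ltW ae.
by exists a.
Qed.

(** The lower bound makes preimages of a convergent sequence Cauchy. Completeness of [U] is a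
    hypothesis on sequences, which [ell1_complete] supplies for [ell1]. *)
Lemma closed_limage (U V : normedModType K) (T : {linear U -> V}) (a b : R) :
  0 < a -> 0 < b ->
  (forall x, rnorm (T x) <= a * rnorm x) ->
  (forall x, rnorm x <= b * rnorm (T x)) ->
  (forall u : nat -> U, rcauchy u ->
    exists l, forall e : R, 0 < e -> \forall n \near \oo, rnorm (u n - l) <= e) ->
  closed [set` limage T].
Proof.
move=> a0 b0 Ta Tb Uc v Av.
have [u uP] : exists u : nat -> U, forall n, rnorm (T (u n) - v) <= n.+1%:R^-1.
  have ex n : exists u, rnorm (T u - v) <= n.+1%:R^-1.
    have [|w /= wT wv] := closure_seq Av (e := n.+1%:R^-1); first by rewrite invr_gt0.
    by move: wT; rewrite inE => -[u uw]; exists u; rewrite uw.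
  by have [u uP] := choice ex; exists u.
have small e : 0 < e -> exists N, forall n, (N <= n)%N -> n.+1%:R^-1 <= e :> R.
  move=> e0; exists (Num.truncn e^-1) => n Nn.
  rewrite -[leRHS]invrK lef_pV2 ?posrE ?invr_gt0//.
  apply: le_trans (ltW (truncnS_gt _)) _.
  by rewrite ler_nat ltnS.
have [|l ul] := Uc u.
  move=> e e0; have [|N NP] := small (e / b / 2); first by rewrite !divr_gt0.
  exists N => m n Nm Nn; apply: le_trans (Tb _) _.
  rewrite mulrC -ler_pdivlMr//.
  have -> : T (u m - u n) = (T (u m) - v) - (T (u n) - v).
    by rewrite linearB opprB addrA subrK.
  apply: le_trans (ler_rnormB _ _) _.
  by have := le_trans (uP m) (NP _ Nm); have := le_trans (uP n) (NP _ Nn); lra.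
suff -> : v = T l by rewrite /= inE; exists l.
apply/eqP; rewrite eq_sym -subr_eq0; apply/eqP/rnorm0_eq0/eqP.
rewrite eq_le rnorm_ge0 andbT; apply/ler_addgt0Pr => e e0; rewrite add0r.
have e2a : 0 < e / 2 / a by rewrite !divr_gt0.
have [N NP] := small (e / 2) (divr_gt0 e0 (ltr0Sn R 1)).
have [M _ MP] := ul _ e2a.
pose n := maxn N M.
have -> : T l - v = (T (u n) - v) - T (u n - l).
  by rewrite linearB opprB [RHS]addrC addrA subrK.
apply: le_trans (ler_rnormB _ _) _; rewrite (splitr e); apply: lerD.
  by apply: le_trans (uP n) _; apply: NP; rewrite leq_maxl.
apply: le_trans (Ta _) _; rewrite mulrC -ler_pdivlMr//.
by apply: MP; rewrite /= leq_maxr.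
Qed.

End closed_range.

(** * Completeness of l1 and copies of l1 *)

Section ell1_facts.
Context {R : realType} {k : scalar_kind}.
Local Notation K := (scalars R k).
Local Notation ell1 := (ell1 R k).
Implicit Types u v : ell1.

Lemma ell1_series_cvg u : cvgn (series (fun n => rnorm (val u n : K^o))).
Proof. by have := valP u; rewrite inE. Qed.

Lemma ell1_partial_le u n : \sum_(i < n) rnorm (val u i : K^o) <= rnorm u.
Proof.
rewrite ell1_normE -(big_mkord xpredT (fun i => rnorm (val u i : K^o))).
apply: (nondecreasing_cvgn_le _ (@ell1_series_cvg u) n).
by apply: nondecreasing_series => i _ _; exact: rnorm_ge0.
Qed.

Lemma ell1_of_bound (f : nat -> K) (C : R) :
  (forall n, \sum_(i < n) rnorm (f i : K^o) <= C) ->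
  exists2 u : ell1, val u = f & rnorm u <= C.
Proof.
move=> fC.
have nd : nondecreasing_seq (series (fun n => rnorm (f n : K^o))).
  by apply: nondecreasing_series => i _ _; exact: rnorm_ge0.
have fC' n : series (fun n => rnorm (f n : K^o)) n <= C.
  by rewrite /series /= big_mkord.
have cf : cvgn (series (fun n => rnorm (f n : K^o))).
  by apply: nondecreasing_is_cvgn => //; exists C => _ [n _ <-].
have f1 : f \in @ell1_pred R k by rewrite inE.
exists (exist _ f f1 : ell1) => //.
by rewrite ell1_normE; apply: limr_le => //; exact: nearW.
Qed.

Lemma ell1_complete (u : nat -> ell1) : rcauchy u ->
  exists l, forall e : R, 0 < e -> \forall n \near \oo, rnorm (u n - l) <= e.
Proof.
move=> uc.
have coord i (w : ell1) : rnorm (val w i : K^o) <= rnorm w.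
  apply: le_trans (ell1_partial_le w i.+1); rewrite big_ord_recr/= lerDr.
  by apply: sumr_ge0 => j _; exact: rnorm_ge0.
have ex i : exists l : K^o, forall e : R, 0 < e ->
    \forall n \near \oo, rnorm ((val (u n) i : K^o) - l) <= e.
  have [|l ul] := @scalar_rcauchy_cvg R k (fun n => val (u n) i).
    move=> e /uc[N NP]; exists N => m n Nm Nn.
    by apply: le_trans (NP m n Nm Nn); exact: (coord i (u m - u n)).
  by exists l; exact/rnorm_cvgP.
have [l lP] := choice ex.
have tail (e : R) : 0 < e -> exists N, forall m, (N <= m)%N ->
    forall n, \sum_(i < n) rnorm (val (u m) i - l i : K^o) <= e.
  move=> e0; have [N NP] := uc _ e0; exists N => m Nm n.
  apply/ler_addgt0Pr => d d0.
  (* The [n] coordinate errors add up to at most [d]; the successor keeps the denominator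
     positive. *)
  pose d' := d / n.+1%:R.
  have d'0 : 0 < d' by rewrite divr_gt0.
  have [M NM MP] : exists2 M, (N <= M)%N &
      forall i : 'I_n, rnorm (val (u M) i - l i : K^o) <= d'.
    have : \forall M \near \oo, forall i : 'I_n,
        rnorm (val (u M) i - l i : K^o) <= d'.
      by apply: filter_forall => i; exact: lP.
    move=> [M0 _ MP]; exists (maxn N M0); first exact: leq_maxl.
    by apply: MP; exact: leq_maxr.
  apply: (@le_trans _ _ (\sum_(i < n) (rnorm (val (u m - u M) i : K^o) + d'))).
    apply: ler_sum => i _.
    have -> : val (u m) i - l i = (val (u m) i - val (u M) i) + (val (u M) i - l i).
      by rewrite addrA subrK.
    by apply: le_trans (@ler_rnormD _ _ K^o _ _) _; rewrite lerD2l.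
  rewrite big_split/=; apply: lerD.
    by apply: le_trans (ell1_partial_le (u m - u M) n) _; exact: NP.
  rewrite sumr_const card_ord -mulr_natr /d' mulrAC ler_pdivrMr//.
  by apply: ler_wpM2l; [exact: ltW|rewrite ler_nat].
have [N0 N0P] := tail 1 ltr01.
have [w wE _] := @ell1_of_bound (fun i => val (u N0) i - l i) 1 (N0P N0 (leqnn _)).
(* The coordinatewise limit [l] belongs to [ell1], being [u N0] minus the summable [w]. *)
exists (u N0 - w) => e e0; have [N NP] := tail e e0; exists N => // m /= Nm.
have [z zE ze] := @ell1_of_bound (fun i => val (u m) i - l i) e (NP m Nm).
suff -> : u m - (u N0 - w) = z by [].
apply: val_inj; apply/funext => i; rewrite zE.
have wi : val w i = val (u N0) i - l i by rewrite wE.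
by rewrite -[LHS]/(val (u m) i - (val (u N0) i - val w i)) wi subKr.
Qed.

End ell1_facts.

Section ell1_copy.
Context {R : realType} {k : scalar_kind}.
Local Notation K := (scalars R k).
Local Notation ell1 := (ell1 R k).

(** The copy is the range of [u] mapped to the sum of the series of the [val u i *: x i], which
    converges absolutely and is bounded below by the minorant. *)
Lemma ell1_minorant_copy (X : completeNormedModType K) (x : nat -> X) :
  (forall n, rnorm (x n) <= 1) -> ell1_minorant x -> contains_copy ell1 X.
Proof.
move=> x1 [d d0 xd].
pose S (u : ell1) n := \sum_(i < n) val u i *: x i.
have S_le u n : rnorm (S u n) <= rnorm u.
  apply: le_trans (ler_rnorm_sum _ _ _) (le_trans _ (ell1_partial_le u n)).
  by apply: ler_sum => i _; rewrite rnormZ; apply: ler_piMr (x1 i); exact: rnorm_ge0.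
have S_cauchy u : rcauchy (S u).
  move=> e e0.
  have /cvg_ex[l /(@rnorm_cvgP R RealScalars R^o)ul] := @ell1_series_cvg R k u.
  have [N _ NP] := ul _ (divr_gt0 e0 (ltr0Sn R 1)).
  pose s := series (fun n => rnorm (val u n : K^o)).
  have diff m n : (m <= n)%N -> rnorm (S u n - S u m) <= s n - s m.
    move=> mn; rewrite /S /s /series/= -!(big_mkord xpredT (fun i => val u i *: x i)).
    rewrite !(big_cat_nat (leq0n m) mn)/= addrAC subrr add0r [X in _ <= X]addrAC subrr add0r.
    apply: le_trans (ler_rnorm_sum _ _ _) _; apply: ler_sum => i _.
    by rewrite rnormZ; apply: ler_piMr (x1 i); exact: rnorm_ge0.
  have sd m n : (N <= m)%N -> (N <= n)%N -> s n - s m <= e.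
    have NP' j : (N <= j)%N -> `|s j - (l : R)| <= e / 2 by exact: NP.
    move=> /NP' + /NP'; rewrite !ler_norml => /andP[+ +] /andP[+ +].
    by move: (s m) (s n) (l : R) => *; lra.
  exists N => m n Nm Nn; have [mn|/ltnW nm] := leqP m n.
    by rewrite rnorm_distC; apply: le_trans (diff _ _ mn) _; exact: sd.
  by apply: le_trans (diff _ _ nm) _; exact: sd.
have ex u : exists y, forall e : R, 0 < e -> \forall n \near \oo, rnorm (S u n - y) <= e.
  have /cvg_ex[l ul] := rcauchy_cvg (S_cauchy u).
  by exists l; exact/rnorm_cvgP.
have [f fP] := choice ex.
have uniq u y : (forall e : R, 0 < e -> \forall n \near \oo, rnorm (S u n - y) <= e) ->
    y = f u.
  move=> /rnorm_cvgP uy; have /rnorm_cvgP uf := fP u.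
  by rewrite -(cvg_lim (@norm_hausdorff _ X) uy) (cvg_lim (@norm_hausdorff _ X) uf).
have fl : linear f.
  move=> a u v; apply/esym/uniq/rnorm_cvgP.
  have -> : S (a *: u + v) = (fun n => a *: S u n + S v n).
    apply/funext => n; rewrite /S scaler_sumr -big_split/=.
    by apply: eq_bigr => i _; rewrite scalerA -scalerDl.
  apply: cvgD; last exact/rnorm_cvgP/fP.
  by apply: cvgZ; [exact: cvg_cst|exact/rnorm_cvgP/fP].
pose T : {linear ell1 -> X} := HB.pack f
  (GRing.isLinear.Build K ell1 X *:%R f fl).
have T_le u : rnorm (T u) <= 1 * rnorm u.
  rewrite mul1r; apply/ler_addgt0Pr => e e0; have [n _ nP] := fP u _ e0.
  have := nP n (leqnn n) => /=; rewrite rnorm_distC => h.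
  have := ler_rnormD (S u n) (f u - S u n); rewrite addrC subrK.
  by have := S_le u n; rewrite /=; lra.
have T_ge u : rnorm u <= d^-1 * rnorm (T u).
  rewrite mulrC ler_pdivlMr// mulrC.
  apply/ler_addgt0Pr => e e0; have [n _ nP] := fP u _ e0.
  rewrite -ler_pdivlMl// ell1_normE; apply: limr_le; first exact: ell1_series_cvg.
  exists n => // m /= nm; rewrite ler_pdivlMl// /series/= big_mkord.
  apply: le_trans (xd m (val u)) _.
  have := nP m nm => /= h.
  by have := ler_rnormD (f u) (S u m - f u); rewrite addrC subrK /S; lra.
have d1 : 0 <= d^-1 by rewrite invr_ge0 ltW.
have [T1 [T2 [iso _ _]]] := limage_isomorphism ler01 d1 T_le T_ge.
eexists; split; last by exists T1, T2.
apply: (@closed_limage R k _ _ T 1 d^-1) => //; first by rewrite invr_gt0.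
exact: ell1_complete.
Qed.

End ell1_copy.

(** * Weakly Cauchy sequences and property (m_oo) *)

Section limsup.
Context {R : realType}.
Implicit Types u v : nat -> \bar R.

Lemma limn_esup_le_near u l : (\forall n \near \oo, (u n <= l)%E) ->
  (limn_esup u <= l)%E.
Proof.
move=> ul; rewrite /limn_esup limf_esupE; apply: ereal_inf_le.
exists (ereal_sup (u @` [set n | (u n <= l)%E])); first by exists [set n | (u n <= l)%E].
by apply: ge_ereal_sup => _ [n /= unl <-].
Qed.

Lemma near_lt_limn_esup u l : (limn_esup u < l)%E ->
  \forall n \near \oo, (u n < l)%E.
Proof.
rewrite /limn_esup limf_esupE => /ereal_inf_lt[_ [V V_oo <-]] Vl.
apply: filterS V_oo => n Vn; apply: le_lt_trans Vl.
by apply: ereal_sup_ubound; exists n.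
Qed.

Lemma limn_esup_ge0 u : (forall n, (0 <= u n)%E) -> (0 <= limn_esup u)%E.
Proof.
move=> u0; rewrite leNgt; apply/negP => /near_lt_limn_esup[n _ /(_ n (leqnn n))/=].
by rewrite ltNge u0.
Qed.

(** Testing against real upper bounds leaves only the trivial case of an infinite right-hand
    side. *)
Lemma limn_esup_le u v : (forall n, (0 <= v n)%E) ->
  (forall r : R, (limn_esup v < r%:E)%E -> (limn_esup u <= r%:E)%E) ->
  (limn_esup u <= limn_esup v)%E.
Proof.
move=> v0 uv; have := limn_esup_ge0 v0; case: (limn_esup v) uv => [r| |]//.
  move=> uv _; apply/lee_addgt0Pr => e e0; rewrite -EFinD; apply: uv.
  by rewrite lte_fin ltrDl.
by move=> _ _; rewrite leey.
Qed.

Lemma limn_esup_maxe (x : R) u : 0 <= x -> (forall n, (0 <= u n)%E) ->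
  limn_esup (fun n => maxe x%:E (u n)) = maxe x%:E (limn_esup u).
Proof.
move=> x0 u0; apply/eqP; rewrite eq_le; apply/andP; split.
  have m0 n : (0 <= maxe x%:E (u n))%E by rewrite le_max lee_fin x0.
  have := limn_esup_ge0 u0; case E : (limn_esup u) => [r| |]// r0; last first.
    by rewrite (_ : maxe _ _ = +oo%E) ?leey// /maxe ltry.
  apply/lee_addgt0Pr => e e0; apply: limn_esup_le_near.
  have mx : x <= Num.max x r by rewrite le_max lexx.
  have mr : r <= Num.max x r by rewrite le_max lexx orbT.
  have : (limn_esup u < (r + e)%:E)%E by rewrite E lte_fin ltrDl.
  move/near_lt_limn_esup; apply: filterS => n /ltW un.
  rewrite -EFin_max -EFinD ge_max lee_fin; apply/andP; split; first lra.
  by apply: le_trans un _; rewrite lee_fin; lra.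
rewrite ge_max; apply/andP; split.
  rewrite leNgt; apply/negP => /near_lt_limn_esup[n _ /(_ n (leqnn n))/=].
  by rewrite gt_max ltxx.
apply: limn_esup_le => [n|r /near_lt_limn_esup rP]; first by rewrite le_max u0 orbT.
by apply: limn_esup_le_near; apply: filterS rP => n; rewrite gt_max => /andP[_ /ltW].
Qed.

End limsup.

Section m_infty.
Context {R : realType} {k : scalar_kind}.
Local Notation K := (scalars R k).
Context {X : normedModType K}.

(** The form in which (m_oo) is applied below: limits superior become eventual bounds with a
    tolerance. *)
Lemma m_infty_bound (x : X) (w : nat -> X) (C : R) : property_m_infty X ->
  weakly_null w -> rnorm x <= C ->
  (forall e : R, 0 < e -> \forall n \near \oo, rnorm (w n) <= C + e) ->
  forall e : R, 0 < e -> \forall n \near \oo, rnorm (x + w n) <= C + e.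
Proof.
move=> mX w0 xC wC e e0.
have : (limn_esup (fun n => (rnorm (x + w n))%:E) < (C + e)%:E)%E.
  rewrite mX// gt_max lte_fin; apply/andP; split; first by lra.
  apply: (@le_lt_trans _ _ (C + e / 2)%:E); last by rewrite lte_fin; lra.
  apply: limn_esup_le_near.
  by apply: filterS (wC (e / 2) _) => [n|]; rewrite ?lee_fin//; lra.
by move/near_lt_limn_esup; apply: filterS => n; rewrite lte_fin => /ltW.
Qed.

End m_infty.

Section convex_blocks.
Context {R : realType} {k : scalar_kind}.
Local Notation K := (scalars R k).
Context {X : normedModType K}.
Variable x : nat -> X.
Hypothesis x1 : forall n, rnorm (x n) <= 1.
Hypothesis xc : wcauchy x.

Local Notation half := (of_real k 2^-1).

(** Dyadic convex combinations suffice, since the iteration only averages two combinations at a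
    time. *)
Inductive tail_conv (N : nat) : X -> Prop :=
| tail_conv_term m : (N <= m)%N -> tail_conv N (x m)
| tail_conv_mid u v : tail_conv N u -> tail_conv N v ->
    tail_conv N (half *: (u + v)).

Lemma tail_convW M N v : (N <= M)%N -> tail_conv M v -> tail_conv N v.
Proof.
move=> NM; elim=> [m Mm|u w _ uN _ wN]; last exact: tail_conv_mid.
by apply: tail_conv_term; exact: leq_trans Mm.
Qed.

Lemma tail_conv_dist (f : X -> K) (c : K) (e : R) N v : lfun f ->
  (forall m, (N <= m)%N -> rnorm (f (x m) - c) <= e) -> tail_conv N v ->
  rnorm (f v - c) <= e.
Proof.
move=> fl fe; elim=> [m|u w _ ue _ we]; first exact: fe.
have cE : c = half * c + half * c.
  by rewrite -mulrDl -of_realD (_ : 2^-1 + 2^-1 = 1 :> R) ?of_real1 ?mul1r//; lra.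
rewrite (lfunZ _ _ fl) (lfunD _ _ fl) {1}cE -mulrDr -mulrBr opprD addrACA.
rewrite rnormM rnorm_of_real ger0_norm ?invr_ge0//.
have := @ler_rnormD _ _ K^o (f u - c) (f w - c); lra.
Qed.

Lemma tail_conv_le1 N v : tail_conv N v -> rnorm v <= 1.
Proof.
elim=> [//|u w _ u1 _ w1]; rewrite rnormZ rnorm_of_real ger0_norm ?invr_ge0//.
have := ler_rnormD u w; lra.
Qed.

Lemma wcauchy_bound (f : X -> K) (C : R) : lfun f -> fbound f C ->
  rcauchy (f \o x : nat -> K^o).
Proof.
move=> fl fC e e0; pose D := Num.max C 1.
have D0 : 0 < D by rewrite lt_max ltr01 orbT.
pose g y := of_real k D^-1 * f y.
have gl : lfun g by move=> a y z; rewrite /g fl; ring.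
have gb : fbound g 1.
  move=> y; rewrite rnormM rnorm_of_real ger0_norm ?invr_ge0 ?(ltW D0)//.
  rewrite mul1r mulrC ler_pdivrMr// mulrC; apply: le_trans (fC y) _.
  by apply: ler_wpM2r; [exact: rnorm_ge0|rewrite le_max lexx].
have [N NP] := xc gl gb (divr_gt0 e0 D0); exists N => m n Nm Nn.
have := NP m n Nm Nn; rewrite /= /g -mulrBr rnormM rnorm_of_real.
by rewrite ger0_norm ?invr_ge0 ?(ltW D0)// mulrC ler_pM2r ?invr_gt0.
Qed.

(** A functional is nearly constant on the late terms of a weakly Cauchy sequence, hence also on
    their convex combinations. *)
Lemma block_weakly_null (a : nat -> K) (n : nat -> nat) (v : nat -> X) (C : R) :
  (forall j, rnorm (a j) <= C) -> (forall j, (j <= n j)%N) ->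
  (forall j, tail_conv j (v j)) -> weakly_null (fun j => a j *: (x (n j) - v j)).
Proof.
move=> aC jn vj f /continuous_rnorm_bound[B B0 fB].
have fl : lfun (f : X -> K) by move=> c y z; rewrite linearP.
apply/(@rnorm_cvgP R k K^o) => e e0; pose D := Num.max C 1.
have D0 : 0 < D by rewrite lt_max ltr01 orbT.
have [N NP] := wcauchy_bound fl fB (divr_gt0 e0 D0).
exists N => // j /= Nj; rewrite subr0 linearZ/= linearB/=.
have -> : a j *: (f (x (n j)) - f (v j)) = a j * (f (x (n j)) - f (v j)) by [].
rewrite rnormM.
have fv : rnorm (f (v j) - f (x (n j))) <= e / D.
  apply: (@tail_conv_dist (f : X -> K) (f (x (n j))) _ j) => // m jm.
  by apply: NP; [exact: leq_trans jm|exact: leq_trans (jn j)].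
apply: (@le_trans _ _ (D * (e / D))); last by rewrite mulrCA divff ?mulr1// gt_eqF.
apply: ler_pM; rewrite ?rnorm_ge0//; last by rewrite (@rnorm_distC _ _ K^o).
by rewrite le_max aC.
Qed.

Hypothesis mX : property_m_infty X.

Let good (a : R) := forall N, exists2 v, tail_conv N v &
  \forall n \near \oo, rnorm (x n - v) <= a.

Let good_step (s : R) : 0 < s -> good (1 + s) -> good (1 + 3 / 4 * s).
Proof.
move=> s0 gs N; pose A := 1 + s; have A0 : 0 < A by rewrite /A; lra.
have vex m : exists v, tail_conv m v /\ \forall n \near \oo, rnorm (x n - v) <= A.
  by have [v v1 v2] := gs m; exists v.
have [v /all_and2[vc vA]] := choice vex.
have u1 := tail_conv_le1 (vc N).
have [m Nm mP] : exists2 m, (N <= m)%N & \forall n \near \oo,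
    rnorm (v N - of_real k A^-1 *: (x n - v m)) <= 1 + s / 4.
  apply: contrapT => nom.
  (* If every [m] fails, the offending indices define a weakly null block sequence that contradicts
     (m_oo) at [v N]. The last clause is void for [j < N], so that [choice] covers all [j]. *)
  have bad j : exists n, [/\ (j <= n)%N, rnorm (x n - v j) <= A &
      (N <= j)%N -> 1 + s / 4 < rnorm (v N - of_real k A^-1 *: (x n - v j))].
    have [M _ MP] := vA j.
    have [Nj|jN] := leqP N j; last first.
      by exists (maxn M j); split; rewrite ?leq_maxr//; apply: MP; rewrite /= leq_maxl.
    apply: contrapT => non; apply: nom; exists j => //.
    exists (maxn M j) => // n /=; rewrite geq_max => /andP[Mn jn].
    rewrite leNgt; apply/negP => h; apply: non; exists n; split=> //; exact: MP.
  have [n /all_and3[jn nA nN]] := choice bad.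
  have w0 := @block_weakly_null (fun=> - of_real k A^-1) n v A^-1 _ jn vc.
  have wA (j : nat) : rnorm (- of_real k A^-1 : K) <= A^-1.
    by rewrite (@rnormN _ _ K^o) rnorm_of_real ger0_norm// invr_ge0 ltW.
  have [||M _ MP] := m_infty_bound mX (w0 wA) u1 _ (_ : 0 < s / 4).
  - move=> e e0; exists 0%N => // j _ /=.
    rewrite rnormZ (@rnormN _ _ K^o) rnorm_of_real ger0_norm ?invr_ge0 ?(ltW A0)//.
    have : A^-1 * rnorm (x (n j) - v j) <= 1 by rewrite mulrC ler_pdivrMr// mul1r.
    by move/le_trans; apply; rewrite lerDl ltW.
  - by rewrite divr_gt0.
  have := nN (maxn M N) (leq_maxr _ _); rewrite ltNge => /negP; apply.
  by have := MP (maxn M N) (leq_maxl _ _); rewrite scaleNr.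
exists (half *: (v N + v m)).
  by apply: tail_conv_mid => //; exact: tail_convW (vc m).
near=> n.
have h1 : rnorm (v N - of_real k A^-1 *: (x n - v m)) <= 1 + s / 4 by near: n.
have h2 : rnorm (x n - v m) <= A by near: n; exact: vA.
pose d := x n - v m; pose c : K := of_real k A^-1.
have hE : x n - half *: (v N + v m) = half *: (x n -
    (v N - of_real k A^-1 *: (x n - v m)) + of_real k (1 - A^-1) *: (x n - v m)).
  have -> : x n - (v N - c *: d) + of_real k (1 - A^-1) *: d = x n + x n - (v N + v m).
    rewrite of_realB of_real1 scalerBl scale1r -/c opprB addrACA.
    rewrite [c *: d - v N + _]addrAC subrr add0r /d addrA -addrA -opprD.
    by rewrite [v m + v N]addrC.
  rewrite scalerBr; congr (_ - _).
  by rewrite scalerDr -scalerDl -of_realD (_ : 2^-1 + 2^-1 = 1 :> R) ?of_real1 ?scale1r//; lra.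
rewrite hE rnormZ rnorm_of_real ger0_norm ?invr_ge0//.
have hA : 0 <= 1 - A^-1.
  by rewrite subr_ge0 invf_le1// /A; lra.
have h3 : rnorm (of_real k (1 - A^-1) *: (x n - v m)) <= s.
  rewrite rnormZ rnorm_of_real ger0_norm//.
  apply: le_trans (ler_wpM2l hA h2) _.
  by rewrite mulrBl mul1r mulVf ?gt_eqF// /A; lra.
(* This equals [1 + 5 / 8 * s]. *)
apply: (@le_trans _ _ (2^-1 * (1 + (1 + s / 4) + s))); last lra.
rewrite ler_pM2l ?invr_gt0//; apply: le_trans (ler_rnormD _ _) _.
apply: lerD h3; apply: le_trans (ler_rnormB _ _) _; exact: lerD.
Unshelve. all: by end_near.
Qed.

Lemma convex_block (e : R) N : 0 < e -> exists2 v, tail_conv N v &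
  \forall n \near \oo, rnorm (x n - v) <= 1 + e.
Proof.
move=> e0.
have g m : good (1 + (3 / 4) ^+ m).
  elim: m => [M|m IH].
    (* The iteration starts from the trivial bound 2 on distances in the unit ball. *)
    exists (x M); first exact: tail_conv_term.
    exists 0%N => // n _ /=; rewrite expr0; apply: le_trans (ler_rnormB _ _) _.
    exact: lerD.
  by rewrite exprS; apply: good_step => //; rewrite exprn_gt0.
have /(@rnorm_cvgP R RealScalars R^o)/(_ e e0)[m _ mP] :
    ((3 / 4 : R) ^+ n @[n --> \oo] --> (0 : R)).
  by apply: cvg_expr; rewrite ger0_norm; lra.
have [v vN vn] := g m N; exists v => //; apply: filterS vn => n vn.
apply: le_trans vn _; rewrite lerD2l.
have := mP m (leqnn m); rewrite /rnorm/= subr0; apply: le_trans; exact: ler_norm.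
Qed.

End convex_blocks.

(** * Dual form of property (m_oo) *)

Section dual_norm.
Context {R : realType} {k : scalar_kind}.
Local Notation K := (scalars R k).
Context {X : normedModType K}.
Implicit Types f g : X -> K.

(** Convertible with [opnorm] of the packed functional, whose bounds are reused through
    [lfun_linear]. *)
Definition dnorm f : R := sup [set rnorm (f x) | x in [set x | rnorm x <= 1]].

Lemma lfun_linear f : lfun f -> exists T : {linear X -> K^o}, f = T.
Proof.
move=> fl; pose T : {linear X -> K^o} := HB.pack (f : X -> K^o)
  (GRing.isLinear.Build K X K^o *:%R f fl).
by exists T.
Qed.

Lemma dnorm_bound f C : lfun f -> fbound f C -> fbound f (dnorm f).
Proof.
move=> /lfun_linear[T ->] TC x.
exact: (opnorm_bound (@rnorm_bound_continuous _ _ X K^o T C TC)).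
Qed.

Lemma dnorm_le f C : 0 <= C -> fbound f C -> dnorm f <= C.
Proof.
move=> C0 fC; apply: ge_sup.
  by exists (rnorm (f 0)), 0 => //=; rewrite rnorm0.
move=> _ [x /= x1 <-]; apply: le_trans (fC x) _.
by rewrite -[leRHS]mulr1; apply: ler_wpM2l.
Qed.

Lemma dnorm_ge0 f C : lfun f -> fbound f C -> 0 <= dnorm f.
Proof.
move=> /lfun_linear[T ->] TC.
exact: (opnorm_ge0 (@rnorm_bound_continuous _ _ X K^o T C TC)).
Qed.

Lemma dnorm_norming f C e : lfun f -> fbound f C -> 0 < e ->
  exists2 x, rnorm x <= 1 & dnorm f - e <= rnorm (f x).
Proof.
move=> fl fC e0.
have [|_ [x /= x1 <-] fx] :=
  @sup_adherent _ [set rnorm (f x) | x in [set x | rnorm x <= 1]] e e0.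
  split; first by exists (rnorm (f 0)), 0 => //=; rewrite rnorm0.
  exists (dnorm f) => _ [x /= x1 <-]; apply: le_trans (dnorm_bound fl fC x) _.
  by rewrite -[leRHS]mulr1; apply: ler_wpM2l => //; exact: dnorm_ge0 fC.
by exists x => //; exact: ltW.
Qed.

Lemma lfun_add f g : lfun f -> lfun g -> lfun (fun x => f x + g x).
Proof. by move=> fl gl a x y; rewrite fl gl; ring. Qed.

Lemma lfun_sub f g : lfun f -> lfun g -> lfun (fun x => f x - g x).
Proof. by move=> fl gl a x y; rewrite fl gl; ring. Qed.

Lemma fbound_add f g C D : fbound f C -> fbound g D ->
  fbound (fun x => f x + g x) (C + D).
Proof.
move=> fC gD x; rewrite mulrDl.
by apply: le_trans (@ler_rnormD _ _ K^o _ _) _; apply: lerD.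
Qed.

Lemma fbound_sub f g C D : fbound f C -> fbound g D ->
  fbound (fun x => f x - g x) (C + D).
Proof.
move=> fC gD x; rewrite mulrDl.
by apply: le_trans (@ler_rnormB _ _ K^o _ _) _; apply: lerD.
Qed.

Lemma fboundW f C D : C <= D -> fbound f C -> fbound f D.
Proof.
move=> CD fC x; apply: le_trans (fC x) _.
by apply: ler_wpM2r => //; exact: rnorm_ge0.
Qed.

End dual_norm.

(* The constant 1 in front of [dnorm (z n)] rests on [convex_block]; differences
   of a weakly Cauchy sequence of the ball would only give 1/2. *)
Lemma dual_asymptotic {R : realType} {k : scalar_kind}
    (X : completeNormedModType (scalars R k)) (f : X -> scalars R k)
    (z : nat -> X -> scalars R k) (C : R) : 0 <= C ->
  property_m_infty X -> ~ contains_copy (ell1 R k) X ->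
  lfun f -> fbound f C -> (forall n, lfun (z n)) -> (forall n, fbound (z n) C) ->
  (forall x (e : R), 0 < e -> \forall n \near \oo, rnorm (z n x) <= e) ->
  forall e : R, 0 < e -> \forall n \near \oo,
    dnorm f + dnorm (z n) <= dnorm (fun x => f x + z n x) + e.
Proof.
move=> C0 mX nol1 fl fC zl zC z0 e e0.
have zl_ n := lfun_add fl (zl n); have zC_ n := fbound_add fC (zC n).
have e8 : 0 < e / 8 by rewrite divr_gt0.
apply: contrapT => nonear.
have Mi : infin [set n | dnorm (fun x => f x + z n x) + e < dnorm f + dnorm (z n)].
  move=> N; apply: contrapT => noM; apply: nonear; exists N => // n /= Nn.
  by rewrite leNgt; apply/negP => h; apply: noM; exists n.
have [s [sS sM]] := infin_enum Mi.
have yex n : exists y, rnorm y <= 1 /\ dnorm (z (s n)) - e / 8 <= rnorm (z (s n) y).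
  by have [y y1 yz] := dnorm_norming (zl (s n)) (zC (s n)) e8; exists y.
have [y /all_and2[y1 yz]] := choice yex.
have [t [tS [mino|xc]]] := rosenthal y1.
  by apply: nol1; apply: ell1_minorant_copy mino => n; exact: y1.
have x1 n : rnorm ((y \o t) n) <= 1 by exact: y1.
set x := y \o t in xc x1.
pose r n := s (t n).
have rge n : (n <= r n)%N.
  by apply: leq_trans (homo_ltn_ge sS _); exact: homo_ltn_ge.
have [p p1 fp] := dnorm_norming fl fC e8.
(* The combination is fixed first and the index second, late enough for the weak*-null sequence to
   be small on the combination. *)
have block j : exists nv : nat * X, [/\ (j <= nv.1)%N, tail_conv x j nv.2,
    rnorm (x nv.1 - nv.2) <= 1 + j.+1%:R^-1 & rnorm (z (r nv.1) nv.2) <= e / 8].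
  have [|v vj [N _ NP]] := convex_block x1 xc mX (e := j.+1%:R^-1) j.
    by rewrite invr_gt0.
  have [M _ MP] := z0 v _ e8.
  pose n := maxn j (maxn N M).
  have jn : (j <= n)%N by rewrite leq_maxl.
  have Nn : (N <= n)%N by rewrite /n !leq_max leqnn orbT.
  have Mn : (M <= n)%N by rewrite /n !leq_max leqnn !orbT.
  exists (n, v); split => //=; first exact: (NP n Nn).
  by apply: (MP (r n)) => /=; exact: leq_trans (rge n).
have [nv /all_and4[jn vj xv zv]] := choice block.
have muex j : exists mu : scalars R k, rnorm mu = 1 /\
    rnorm (f p + mu * z (r (nv j).1) (x (nv j).1)) =
    rnorm (f p) + rnorm (z (r (nv j).1) (x (nv j).1)) by exact: rnorm_align.
have [mu /all_and2[mu1 muP]] := choice muex.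
(* The rotation makes the value of the [z]-term at [w j] add to [f p] in modulus, up to a small
   error. *)
pose w j := mu j *: (x (nv j).1 - (nv j).2).
have w0 : weakly_null w.
  apply: (@block_weakly_null _ _ _ _ xc mu
    (fun j => (nv j).1) (fun j => (nv j).2) 1) => // j.
  by rewrite mu1.
have w1 (d : R) : 0 < d -> \forall j \near \oo, rnorm (w j) <= 1 + d.
  move=> d0; have [N _ NP] := (near_infty_natSinv_lt (PosNum d0)).
  exists N => // j /NP /= /ltW jd.
  by rewrite rnormZ mu1 mul1r; apply: le_trans (xv j) _; rewrite lerD2l.
(* As [dnorm] of the sum is at most [2 * C], the excess of [rnorm (p + w j)] over 1 costs at most
   [e / 8]. *)
pose tau := e / 8 / (2 * C + 1).
have tau0 : 0 < tau by rewrite divr_gt0//; lra.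
have [T fT] := lfun_linear fl.
have Tc : continuous T.
  by apply: (@rnorm_bound_continuous _ _ X _ T C); move: fC; rewrite fT.
have fw : \forall j \near \oo, rnorm (f (w j)) <= e / 8.
  have /(@rnorm_cvgP _ _ (scalars R k)^o)/(_ _ e8) := w0 T Tc.
  by apply: filterS => j; rewrite subr0 fT.
have pw := m_infty_bound mX w0 p1 w1 tau0.
have [j [fwj pwj zpj]] : exists j, [/\ rnorm (f (w j)) <= e / 8,
    rnorm (p + w j) <= 1 + tau & rnorm (z (r (nv j).1) p) <= e / 8].
  have [N1 _ N1P] := fw; have [N2 _ N2P] := pw; have [N3 _ N3P] := z0 p _ e8.
  pose j := maxn N1 (maxn N2 N3); exists j; split.
  - by apply: N1P; rewrite /= leq_maxl.
  - by apply: N2P; rewrite /= /j !leq_max leqnn orbT.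
  - apply: N3P => /=; apply: leq_trans (rge _); apply: leq_trans (jn j).
    by rewrite /j !leq_max leqnn !orbT.
set n := r (nv j).1 in zpj.
have big := sM (t (nv j).1); rewrite /= -/(r _) -/n in big.
have low := yz (t (nv j).1); rewrite -/(r _) -/n -/(x _) in low.
have := dnorm_bound (zl_ n) (zC_ n) (p + w j).
have -> : f (p + w j) + z n (p + w j) =
  (f p + mu j * z n (x (nv j).1)) - (- f (w j) - z n p + mu j * z n (nv j).2).
  rewrite (lfunD _ _ fl) (lfunD _ _ (zl n)) {3}/w (lfunZ _ _ (zl n)) (lfunB _ _ (zl n)).
  by ring.
have err : rnorm (- f (w j) - z n p + mu j * z n (nv j).2) <= e / 8 + e / 8 + e / 8.
  apply: le_trans (@ler_rnormD _ _ (scalars R k)^o _ _) _; apply: lerD.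
    apply: le_trans (@ler_rnormB _ _ (scalars R k)^o _ _) _; apply: lerD => //.
    by rewrite (@rnormN _ _ (scalars R k)^o).
  by rewrite rnormM mu1 mul1r; exact: zv.
have := @ler_rnorm_dist _ _ (scalars R k)^o (f p + mu j * z n (x (nv j).1))
  (- f (w j) - z n p + mu j * z n (nv j).2).
rewrite muP -/n => h1 h2.
have D0 := dnorm_ge0 (zl_ n) (zC_ n).
have D1 : dnorm (fun x => f x + z n x) <= 2 * C.
  by apply: dnorm_le; [lra|apply: fboundW (zC_ n); lra].
have h3 : dnorm (fun x => f x + z n x) * rnorm (p + w j) <=
    dnorm (fun x => f x + z n x) + e / 8.
  apply: le_trans (ler_wpM2l D0 pwj) _.
  rewrite mulrDr mulr1 lerD2l; apply: (@le_trans _ _ ((2 * C + 1) * tau)).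
    by apply: ler_wpM2r; [exact: ltW|lra].
  by rewrite /tau mulrCA divff ?mulr1//; lra.
(* Two errors [e / 8] come from norming, three from [err] and one from [h3]: less than the gap [e]
   in [big]. *)
lra.
Qed.

(** * Almost norming weak*-null sequences *)

Section dense_sequence.
Context {R : realType} {k : scalar_kind}.
Local Notation K := (scalars R k).
Context {X : normedModType K}.

Lemma separable_sequence : separable X -> exists d : nat -> X,
  forall x (e : R), 0 < e -> exists i, rnorm (x - d i) <= e.
Proof.
move=> [A /countable_injP[f finj] Ad].
(* Integers that code no point of [A] receive the vector 0. *)
have dex n : exists x, forall a, A a -> f a = n -> a = x.
  have [[a [Aa fa]]|noa] := pselect (exists a, A a /\ f a = n).
    by exists a => b Ab fb; apply: finj; rewrite ?inE// fb.
  by exists 0 => a Aa fa; exfalso; apply: noa; exists a.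
have [d dP] := choice dex; exists d => x e e0.
have e0K : 0 < of_real k e :> K by rewrite -(of_real0 (R := R)) ltr_of_real.
have [||a [xa Aa]] := Ad (ball x (of_real k e)).
- by exists x; exact: ballxx.
- exact: ball_open.
exists (f a); rewrite -(dP _ a Aa erefl).
by move: xa; rewrite -ball_normE /= -rnorm_lt => /ltW.
Qed.

End dense_sequence.

Section weak_star.
Context {R : realType} {k : scalar_kind}.
Local Notation K := (scalars R k).
Context {X : normedModType K}.
Variable d : nat -> X.
Hypothesis d_dense : forall x (e : R), 0 < e -> exists i, rnorm (x - d i) <= e.

Lemma near_natSinv_le (e : R) : 0 < e -> \forall n \near \oo, n.+1%:R^-1 <= e.
Proof.
move=> e0; have [N _ NP] := near_infty_natSinv_lt (PosNum e0).
by exists N => // n /NP /= /ltW.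
Qed.

Lemma dense_pointwise_null (z : nat -> X -> K) (C : R) :
  (forall n, dual_ball C (z n)) ->
  (forall i (e : R), 0 < e -> \forall n \near \oo, rnorm (z n (d i)) <= e) ->
  forall x (e : R), 0 < e -> \forall n \near \oo, rnorm (z n x) <= e.
Proof.
move=> zC zd x e e0; pose D := Num.max C 1.
have D0 : 0 < D by rewrite lt_max ltr01 orbT.
have [i xi] : exists i, rnorm (x - d i) <= e / 2 / D.
  by apply: d_dense; rewrite !divr_gt0.
have e20 : 0 < e / 2 by rewrite divr_gt0.
apply: filterS (zd i _ e20) => n zn; have [zl zb] := zC n.
rewrite -(subrK (d i) x) (lfunD _ _ zl); apply: le_trans (@ler_rnormD _ _ K^o _ _) _.
rewrite (splitr e); apply: lerD => //; apply: le_trans (zb _) _.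
apply: (@le_trans _ _ (D * rnorm (x - d i))).
  by apply: ler_wpM2r; [exact: rnorm_ge0|rewrite le_max lexx].
by rewrite mulrC -ler_pdivlMr.
Qed.

(** Sequential weak*-compactness. The diagonal runs over pairs of a dense vector and a precision;
    equicontinuity extends convergence to all vectors. *)
Lemma alaoglu (g : nat -> X -> K) (C : R) : (forall n, dual_ball C (g n)) ->
  exists (s : nat -> nat) (f : X -> K),
    [/\ forall n, (s n < s n.+1)%N, dual_ball C f &
      forall x (e : R), 0 < e -> \forall n \near \oo, rnorm (g (s n) x - f x) <= e].
Proof.
move=> gC; pose rho m : R := m.+1%:R^-1.
have rho0 m : 0 < rho m by rewrite invr_gt0.
pose Q (p : nat) (N : set nat) := forall i m, unpickle p = Some (i, m) ->
  exists b, forall a c, N a -> N c -> (b <= a)%N -> (b <= c)%N ->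
    rnorm (g a (d i) - g c (d i)) <= 2 * rho m.
have [||N [Ni _ NQ]] := @diagonal_infin Q _ _ setT infinT.
- move=> p M N b QM NM i m pE; have [c cP] := QM i m pE.
  exists (maxn b c) => a a' Na Na'; rewrite !geq_max => /andP[ba ca] /andP[ba' ca'].
  exact: (cP _ _ (NM _ ba Na) (NM _ ba' Na') ca ca').
- move=> p M Mi; case pE : (unpickle p : option (nat * nat)) => [[i m]|]; last first.
    by exists M; split=> // i m; rewrite pE.
  have [grid gridP] := scalar_grid (k := k) (C * rnorm (d i)) (rho0 m).
  have [j jio] : exists j, io M [set n | rnorm (g n (d i) - grid`_j) <= rho m].
    apply: contrapT => noj.
    have [j jm jio|b bP] := @eventually_avoid M (size grid)
        (fun j => [set n | rnorm (g n (d i) - grid`_j) <= rho m]).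
      by apply: noj; exists j.
    have [n bn Mn] := Mi b; have [a ag ax] := gridP _ ((gC n).2 (d i)).
    by apply: (bP n (index a grid) Mn bn); rewrite ?index_mem//= nth_index.
  exists (M `&` [set n | rnorm (g n (d i) - grid`_j) <= rho m]).
  split; [exact: jio|by move=> n []|].
  move=> i' m'; rewrite pE => -[<- <-]; exists 0%N => a c [_ /= ha] [_ /= hc] _ _.
  have -> : g a (d i) - g c (d i) = (g a (d i) - grid`_j) - (g c (d i) - grid`_j) by ring.
  apply: le_trans (@ler_rnormB _ _ K^o _ _) _.
  by rewrite mulrDl mul1r; apply: lerD.
have [s [sS sN]] := infin_enum Ni.
pose D := Num.max C 1; have D0 : 0 < D by rewrite lt_max ltr01 orbT.
have gD n x : rnorm (g n x) <= D * rnorm x.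
  by apply: le_trans ((gC n).2 x) _; apply: ler_wpM2r; [exact: rnorm_ge0|rewrite le_max lexx].
have cauchy x : rcauchy (fun n => g (s n) x : K^o).
  move=> e e0.
  have [i xi] : exists i, rnorm (x - d i) <= e / 4 / D.
    by apply: d_dense; rewrite !divr_gt0.
  have [m _ /(_ m (leqnn m)) /= me] := near_natSinv_le (divr_gt0 e0 (ltr0Sn R 3)).
  have [b bP] := NQ (pickle (i, m)) i m (pickleK _).
  exists b => p q bp bq.
  have := bP _ _ (sN p) (sN q)
    (leq_trans bp (homo_ltn_ge sS _)) (leq_trans bq (homo_ltn_ge sS _)).
  have gx n : rnorm (g n (x - d i)) <= e / 4.
    by apply: le_trans (gD _ _) _; rewrite mulrC -ler_pdivlMr.
  have -> : g (s p) x - g (s q) x = (g (s p) (d i) - g (s q) (d i)) +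
      (g (s p) (x - d i) - g (s q) (x - d i)).
    by rewrite (lfunB _ _ (gC (s p)).1) (lfunB _ _ (gC (s q)).1); ring.
  move=> h; apply: le_trans (@ler_rnormD _ _ K^o _ _) _; rewrite (splitr e).
  apply: lerD.
    by apply: le_trans h _; move: (rho m) (me : rho m <= e / 4) => r re; lra.
  apply: le_trans (@ler_rnormB _ _ K^o _ _) _.
  by apply: le_trans (lerD (gx _) (gx _)) _; lra.
have lim x : exists l : K^o, g (s n) x @[n --> \oo] --> l.
  exact: scalar_rcauchy_cvg.
have [f fP] := choice lim.
have uniq x l : (fun n => g (s n) x : K^o) n @[n --> \oo] --> (l : K^o) -> l = f x.
  move=> gl; rewrite -(cvg_lim (@norm_hausdorff _ K^o) gl).
  by rewrite (cvg_lim (@norm_hausdorff _ K^o) (fP x)).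
exists s, f; split=> //.
- split.
    move=> a x y; apply/esym/uniq.
    have -> : (fun n => g (s n) (a *: x + y)) = (fun n => a * g (s n) x + g (s n) y).
      by apply/funext => n; rewrite (gC _).1.
    by apply: cvgD; [apply: cvgM; [exact: cvg_cst|]|]; exact: fP.
  move=> x; apply/ler_addgt0Pr => e e0.
  have /(@rnorm_cvgP _ _ K^o)/(_ e e0)[N0 _ /(_ N0 (leqnn N0)) /= h] := fP x.
  have := (gC (s N0)).2 x.
  have := @ler_rnormB _ _ K^o (g (s N0) x) (g (s N0) x - f x); rewrite subKr; lra.
- by move=> x; exact/(@rnorm_cvgP _ _ K^o)/fP.
Qed.

End weak_star.

Section finite_cover.
Context {R : realType} {k : scalar_kind}.
Local Notation K := (scalars R k).
Context {X : completeNormedModType K}.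
Variable d : nat -> X.
Hypothesis d_dense : forall x (e : R), 0 < e -> exists i, rnorm (x - d i) <= e.
Hypothesis mX : property_m_infty X.
Hypothesis noell1 : ~ contains_copy (ell1 R k) X.

(** The second clause is what allows the norms of successive pieces to be summed. *)
Definition splits n (delta : R) (f g : X -> K) :=
  (forall i, (i < n)%N -> rnorm (g (d i) - f (d i)) <= delta) /\
  dnorm f + dnorm (fun x => g x - f x) <= dnorm g + delta.

(* Any [h] close enough to [f] on the [d i] splits along [f] itself, by
   [dual_asymptotic]; this is the Lebesgue number of that cover. *)
Lemma splits_uniform (C delta : R) n : 0 <= C -> 0 < delta -> exists m,
  forall g, dual_ball C g -> exists2 f, dual_ball C f & forall h, dual_ball C h ->
    (forall i, (i < m)%N -> rnorm (h (d i) - g (d i)) <= m.+1%:R^-1) ->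
    splits n delta f h.
Proof.
move=> C0 delta0; apply: contrapT => nom.
have bad m : exists g, dual_ball C g /\ forall f, dual_ball C f -> exists h,
    [/\ dual_ball C h,
      forall i, (i < m)%N -> rnorm (h (d i) - g (d i)) <= m.+1%:R^-1 &
      ~ splits n delta f h].
  apply: contrapT => nog; apply: nom; exists m => g gC.
  apply: contrapT => nof; apply: nog; exists g; split=> // f fC.
  apply: contrapT => noh; apply: nof; exists f => // h hC hg.
  by apply: contrapT => ns; apply: noh; exists h.
have [g /all_and2[gC gP]] := choice bad.
(* The centres of the failing neighbourhoods cluster at [f], which is then used as the candidate
   piece; the corresponding [h j] also tend weak* to [f]. *)
have [s [f [sS fC gf]]] := alaoglu d_dense gC.
have [h /all_and3[hC hg hns]] := choice (fun j => gP (s j) f fC).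
pose z j x := h j x - f x.
have zC j : dual_ball (C + C) (z j).
  split; first exact: lfun_sub (hC j).1 fC.1.
  exact: fbound_sub (hC j).2 fC.2.
have zd i (e : R) : 0 < e -> \forall j \near \oo, rnorm (z j (d i)) <= e.
  move=> e0; have e20 : 0 < e / 2 by rewrite divr_gt0.
  have [N1 _ N1P] := gf (d i) _ e20.
  have [N2 _ N2P] := near_natSinv_le e20.
  exists (maxn i.+1 (maxn N1 N2)) => // j /=; rewrite !geq_max => /and3P[ij N1j N2j].
  have js := homo_ltn_ge sS j.
  have := hg j i (leq_trans ij js); have := N1P j N1j; have := N2P (s j) (leq_trans N2j js).
  move=> /= h1 h2 h3.
  have -> : z j (d i) = (h j (d i) - g (s j) (d i)) + (g (s j) (d i) - f (d i)).
    by rewrite /z; ring.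
  apply: le_trans (@ler_rnormD _ _ K^o _ _) _; rewrite (splitr e).
  by apply: lerD => //; exact: le_trans h3 h1.
have z0 := dense_pointwise_null d_dense zC zd.
have CC : C <= C + C by lra.
have [N1 _ N1P] := dual_asymptotic (addr_ge0 C0 C0) mX noell1 fC.1 (fboundW CC fC.2)
  (fun j => (zC j).1) (fun j => (zC j).2) z0 delta0.
have [N2 _ N2P] : \forall j \near \oo, forall i : 'I_n, rnorm (z j (d i)) <= delta.
  by apply: filter_forall => i; exact: zd.
pose j := maxn N1 N2.
apply: (hns j); split.
  by move=> i ni; apply: (N2P j _ (Ordinal ni)); rewrite /= leq_maxr.
have := N1P j (leq_maxl _ _) => /=.
by have -> : (fun x => f x + z j x) = h j by apply/funext => x; rewrite /z addrC subrK.
Qed.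

(** Functionals with the same rounded values at the first [m] dense vectors are within the Lebesgue
    number of each other, hence share a piece, and there are finitely many codes. *)
Lemma finite_splitting (C delta : R) n : 0 <= C -> 0 < delta ->
  exists (I : finType) (L : I -> X -> K), (forall c, dual_ball C (L c)) /\
    forall g, dual_ball C g -> exists c, splits n delta (L c) g.
Proof.
move=> C0 delta0; have [m mP] := splits_uniform n C0 delta0.
pose rho : R := m.+1%:R^-1 / 2.
have rho0 : 0 < rho by rewrite divr_gt0// invr_gt0.
have [grid gridP] : exists grid : nat -> seq K, forall i t,
    rnorm t <= C * rnorm (d i) -> exists2 a, a \in grid i & rnorm (t - a) <= rho.
  have [grid gridP] := choice (fun i => scalar_grid (k := k) (C * rnorm (d i)) rho0).
  by exists grid.
pose M := \max_(i < m) size (grid i).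
pose codes (c : {ffun 'I_m -> 'I_M.+1}) : set (X -> K) :=
  [set g | forall i : 'I_m, rnorm (g (d i) - (grid i)`_(c i)) <= rho].
have Lex (c : {ffun 'I_m -> 'I_M.+1}) : exists f, dual_ball C f /\
    forall g, dual_ball C g -> codes c g -> splits n delta f g.
  have [[g [gC gc]]|nog] := pselect (exists g, dual_ball C g /\ codes c g); last first.
    (* Codes realized by no functional of the ball receive 0. *)
    exists (fun=> 0); split; last by move=> g gC gc; exfalso; apply: nog; exists g.
    split; first by move=> a x y; rewrite mulr0 addr0.
    by move=> x; rewrite rnorm0 mulr_ge0// rnorm_ge0.
  have [f fC fP] := mP g gC; exists f; split=> // h hC hc.
  apply: fP => // i im; have := hc (Ordinal im); have := gc (Ordinal im) => /= h1 h2.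
  have -> : h (d i) - g (d i) = (h (d i) - (grid i)`_(c (Ordinal im))) -
    (g (d i) - (grid i)`_(c (Ordinal im))) by ring.
  apply: le_trans (@ler_rnormB _ _ K^o _ _) _; rewrite [leRHS]splitr; exact: lerD.
have [L /all_and2[LC LP]] := choice Lex.
exists {ffun 'I_m -> 'I_M.+1}, L; split=> // g gC.
have cex (i : 'I_m) : exists j : 'I_M.+1, rnorm (g (d i) - (grid i)`_j) <= rho.
  have [a ag ga] := gridP i _ (gC.2 (d i)).
  have jM : (index a (grid i) < M.+1)%N.
    rewrite ltnS; apply: leq_trans (index_size _ _) _.
    exact: (leq_bigmax (F := fun i : 'I_m => size (grid i))).
  by exists (Ordinal jM); rewrite /= nth_index.
have [c cP] := choice cex.
by exists [ffun i => c i]; apply: LP => // i; rewrite ffunE.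
Qed.

End finite_cover.

Section norming_sequence.
Context {R : realType} {k : scalar_kind}.
Local Notation K := (scalars R k).
Context {X : completeNormedModType K}.
Variable d : nat -> X.
Hypothesis d_dense : forall x (e : R), 0 < e -> exists i, rnorm (x - d i) <= e.
Hypothesis mX : property_m_infty X.
Hypothesis noell1 : ~ contains_copy (ell1 R k) X.

Lemma sum_half_le1 n : \sum_(i < n) (2^-1 : R) ^+ i.+1 <= 1.
Proof.
have -> : \sum_(i < n) (2^-1 : R) ^+ i.+1 = 1 - 2^-1 ^+ n.
  elim: n => [|n IH]; first by rewrite big_ord0 expr0 subrr.
  by rewrite big_ord_recr/= IH exprS; lra.
by rewrite gerBl exprn_ge0// invr_ge0.
Qed.

Lemma sum_quarter_le1 n : \sum_(i < n) (4^-1 : R) ^+ i.+1 <= 1.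
Proof.
apply: le_trans (sum_half_le1 n); apply: ler_sum => i _.
by rewrite lerXn2r ?nnegrE ?invr_ge0//; lra.
Qed.

Variable eps : R.
Hypothesis eps0 : 0 < eps.
Hypothesis eps4 : eps <= 1 / 4.

(** [delta s] is the tolerance of the [s]-th splitting, [eta s] the norm below which a piece is
    dropped. Both have sums at most [eps], and [delta s / eta s] tends to 0, which keeps normalized
    pieces weak*-null. *)
Let delta s := eps * 4^-1 ^+ s.+1.
Let eta s := eps * 2^-1 ^+ s.+1.

Let delta0 s : 0 < delta s.
Proof. by rewrite mulr_gt0// exprn_gt0// invr_gt0. Qed.

Let eta0 s : 0 < eta s.
Proof. by rewrite mulr_gt0// exprn_gt0// invr_gt0. Qed.

Let deltaS s : delta s = 4 * delta s.+1.
Proof. by rewrite /delta [in RHS]exprS mulrCA mulVKf. Qed.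

Let delta_eta s : delta s = eta s * 2^-1 ^+ s.+1.
Proof. by rewrite /delta /eta -mulrA -exprMn; congr (_ * _ ^+ _); rewrite -invfM -natrM. Qed.

Let sum_delta n : \sum_(s < n) delta s <= eps.
Proof.
by rewrite -mulr_sumr -[leRHS]mulr1; apply: ler_wpM2l; [exact: ltW|exact: sum_quarter_le1].
Qed.

Let sum_eta n : \sum_(s < n) eta s <= eps.
Proof.
by rewrite -mulr_sumr -[leRHS]mulr1; apply: ler_wpM2l; [exact: ltW|exact: sum_half_le1].
Qed.

(** Near additivity telescopes: the norms of the pieces and of the remainder sum to at most
    [1 + eps], so the remainders never leave the ball of radius 2. [P s] records the finite set from
    which the piece comes. *)
Lemma greedy_decomposition (P : nat -> set (X -> K)) :
  (forall s g, dual_ball 2 g -> exists2 y, dual_ball 2 y /\ P s y &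
     splits d s.+1 (delta s) y g) ->
  forall g0, dual_ball 1 g0 -> exists (g y : nat -> X -> K),
    [/\ g 0%N = g0, forall s, dual_ball 2 (g s), forall s, P s (y s),
      forall s x, g s x = y s x + g s.+1 x &
      forall s, [/\ dual_ball 2 (y s), splits d s.+1 (delta s) (y s) (g s) &
        \sum_(t < s) dnorm (y t) <= 1 + eps]].
Proof.
move=> split g0 [g0l g0b].
(* Nothing is required outside the ball, so [pick] is total in [g]. *)
have ex s g : exists y, dual_ball 2 g ->
    [/\ dual_ball 2 y, P s y & splits d s.+1 (delta s) y g].
  have [gb|ngb] := pselect (dual_ball 2 g); last by exists g.
  by have [y [y2 Py] gy] := split s g gb; exists y.
pose pick s g := sval (cid (ex s g)).
have pickP s g := svalP (cid (ex s g)).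
pose g := fix g n := if n is s.+1 then (fun x => g s x - pick s (g s) x) else g0.
pose y s := pick s (g s).
have gE s x : g s.+1 x = g s x - y s x by [].
have yP s : dual_ball 2 (g s) ->
  [/\ dual_ball 2 (y s), P s (y s) & splits d s.+1 (delta s) (y s) (g s)] by exact: pickP.
have inv s : [/\ dual_ball 2 (g s), 0 <= \sum_(t < s) dnorm (y t) &
    \sum_(t < s) dnorm (y t) + dnorm (g s) <= 1 + \sum_(t < s) delta t].
  elim: s => [|s [gs sum0 IH]].
    rewrite !big_ord0 add0r addr0; split=> //; last exact: dnorm_le.
    by split=> //; apply: fboundW g0b; lra.
  have [[yl yb] _ [_ ys]] := yP s gs.
  have sum_le : \sum_(t < s.+1) dnorm (y t) + dnorm (g s.+1) <=
      1 + \sum_(t < s.+1) delta t.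
    by move: IH ys; rewrite !big_ord_recr/= -/(y s); lra.
  have sum1 : 0 <= \sum_(t < s.+1) dnorm (y t).
    by rewrite big_ord_recr addr_ge0//=; exact: dnorm_ge0 yb.
  split=> //; have gl : lfun (g s.+1) by exact: lfun_sub gs.1 yl.
  (* This crude bound only gives access to [dnorm_bound]; the radius 2 is recovered from
     [sum_le]. *)
  have gb : fbound (g s.+1) (2 + 2) by exact: fbound_sub gs.2 yb.
  split=> //; apply: fboundW (dnorm_bound gl gb).
  have sd := sum_delta s.+1.
  apply: (@le_trans _ _ (1 + eps)); last by have := eps4; lra.
  apply: (@le_trans _ _ (1 + \sum_(t < s.+1) delta t)); last by rewrite lerD2l.
  by apply: le_trans sum_le; rewrite lerDr.
exists g, y; split=> // [s|s|s x|s].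
- by have [] := inv s.
- by have [gs _ _] := inv s; have [] := yP s gs.
- by rewrite gE addrC subrK.
- have [gs _ le] := inv s; have [yb _ sp] := yP s gs; split=> //.
  have [gl gb] := gs.
  by have := dnorm_ge0 gl gb; have := sum_delta s; lra.
Qed.

(* [8 * delta s] bounds the pieces of [greedy_decomposition] on the first [s]
   vectors of [d]: such a piece is a difference of remainders that are at most
   [delta s.-1 = 4 * delta s] and [delta s] there. *)
Let flat s (y : X -> K) := eta s <= dnorm y /\
  forall i, (i < s)%N -> rnorm (y (d i)) <= 8 * delta s.

(** The finite families may contain members that are not small on the first vectors of [d]; sending
    these to 0 protects weak*-convergence. *)
Let normalize s (y : X -> K) : X -> K := fun x =>
  if `[< flat s y >] then of_real k (dnorm y)^-1 * y x else 0.

Let normalize_ball s y : dual_ball 2 y -> dual_ball 1 (normalize s y).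
Proof.
move=> [yl yb]; have [fl|nfl] := pselect (flat s y); last first.
  have -> : normalize s y = fun=> 0 by rewrite /normalize asboolF.
  split=> [a x z|x]; first by rewrite mulr0 addr0.
  by rewrite rnorm0 mulr_ge0// rnorm_ge0.
have -> : normalize s y = fun x => of_real k (dnorm y)^-1 * y x.
  by rewrite /normalize asboolT.
have y0 : 0 < dnorm y by case: fl => + _; exact: lt_le_trans.
split=> [a x z|x]; first by rewrite yl; ring.
rewrite rnormM rnorm_of_real ger0_norm ?invr_ge0 ?(ltW y0)// mul1r.
by rewrite mulrC ler_pdivrMr// mulrC; exact: dnorm_bound yb _.
Qed.

Let normalize_small s y i : (i < s)%N ->
  rnorm (normalize s y (d i)) <= 8 * 2^-1 ^+ s.+1.
Proof.
move=> si; rewrite /normalize; case: asboolP => [[yeta ysmall]|_]; last first.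
  by rewrite rnorm0 mulr_ge0// exprn_ge0// invr_ge0.
have y0 : 0 < dnorm y by exact: lt_le_trans yeta.
rewrite rnormM rnorm_of_real ger0_norm ?invr_ge0 ?(ltW y0)//.
rewrite mulrC ler_pdivrMr//; apply: le_trans (ysmall i si) _.
rewrite delta_eta mulrCA mulrC; exact: ler_wpM2l.
Qed.

(** A piece small on the first vectors can only be dropped for having norm below [eta s], which the
    second summand pays for. *)
Let normalize_norming s y x b : dual_ball 2 y ->
  (forall i, (i < s)%N -> rnorm (y (d i)) <= 8 * delta s) ->
  rnorm (normalize s y x) <= b ->
  rnorm (y x) <= dnorm y * b + eta s * rnorm x.
Proof.
move=> [yl yb] ysmall; have D0 := dnorm_ge0 yl yb.
have E0 : 0 <= eta s * rnorm x by rewrite mulr_ge0 ?rnorm_ge0// ltW.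
rewrite /normalize; case: asboolP => [[yeta _]|nfl] yxb.
  have y0 : 0 < dnorm y by exact: lt_le_trans yeta.
  move: yxb; rewrite rnormM rnorm_of_real ger0_norm ?invr_ge0 ?(ltW y0)//.
  rewrite mulrC ler_pdivrMr// mulrC => yxb.
  by apply: le_trans yxb _; rewrite lerDl.
have b0 : 0 <= b by move: yxb; rewrite rnorm0.
have yeta : dnorm y <= eta s.
  by rewrite leNgt; apply/negP => /ltW ye; apply: nfl; split.
apply: le_trans (dnorm_bound yl yb x) _.
apply: (@le_trans _ _ (eta s * rnorm x)); last by rewrite lerDr mulr_ge0.
by apply: ler_wpM2r => //; exact: rnorm_ge0.
Qed.

Lemma norming_null_sequence : exists phi : nat -> X -> K,
  [/\ forall n, dual_ball 1 (phi n),
      forall x (e : R), 0 < e -> \forall n \near \oo, rnorm (phi n x) <= e &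
      forall x b, (forall n, rnorm (phi n x) <= b) ->
        (1 - 2 * eps) * rnorm x <= (1 + eps) * b].
Proof.
have fam s : exists IL : {I : finType & I -> X -> K},
    (forall c, dual_ball 2 (projT2 IL c)) /\
    forall g, dual_ball 2 g -> exists c, splits d s.+1 (delta s) (projT2 IL c) g.
  have [I [L LP]] := finite_splitting d_dense mX noell1 s.+1 (ler0n R 2) (delta0 s).
  by exists (existT _ I L).
have [IL /all_and2[ILb ILs]] := choice fam.
pose I s : finType := projT1 (IL s).
pose L s : I s -> X -> K := projT2 (IL s).
(* The pieces of all stages are listed through their codes; integers that code nothing give 0. *)
pose phi n x : K := if @pickle_inv {s & I s} n is Some t
  then normalize (tag t) (L (tag t) (tagged t)) x else 0.
have phi_ball n : dual_ball 1 (phi n).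
  rewrite /phi; case: pickle_inv => [t|].
    exact: (@normalize_ball (tag t) (L (tag t) (tagged t)) (ILb _ _)).
  split=> [a x z|x]; first by rewrite mulr0 addr0.
  by rewrite rnorm0 mulr_ge0// rnorm_ge0.
exists phi; split=> //.
  apply: (dense_pointwise_null d_dense phi_ball) => i e e0.
  have [S0 _ S0P] : \forall s \near \oo, 8 * (2^-1 : R) ^+ s.+1 <= e.
    have e8 : 0 < e / 4 by rewrite divr_gt0.
    have /(@rnorm_cvgP R RealScalars R^o)/(_ _ e8) :
        ((2^-1 : R) ^+ n @[n --> \oo] --> (0 : R)).
      by apply: cvg_expr; rewrite ger0_norm; lra.
    apply: filterS => s; rewrite subr0 /rnorm/= ger0_norm ?exprn_ge0 ?invr_ge0//.
    by rewrite exprS; lra.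
  pose S := maxn S0 i.+1.
  (* The stages before [S] have finitely many pieces, so indices beyond [B] belong to later ones or
     code nothing. *)
  pose B := \max_(s < S) \max_(c : I s) pickle (Tagged I c : {s & I s}).
  exists B.+1 => // n /= Bn; rewrite /phi.
  case nE : pickle_inv => [[s c]|]; last by rewrite rnorm0 ltW.
  have [sS|Ss] := ltnP s S; last first.
    have [S0s si] : (S0 <= s)%N /\ (i < s)%N.
      by move: Ss; rewrite geq_max => /andP[].
    by apply: le_trans (normalize_small _ si) _; exact: S0P.
  suff : (n <= B)%N by rewrite leqNgt Bn.
  have <- : pickle (Tagged I c : {s & I s}) = n.
    by have := pickle_invK (T := {s & I s}) n; rewrite nE.
  apply: leq_trans (leq_bigmax (F := fun s : 'I_S =>
    \max_(c : I s) pickle (Tagged I c : {s & I s})) (Ordinal sS)).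
  exact: (leq_bigmax (F := fun c : I s => pickle (Tagged I c : {s & I s}))).
move=> x b phib.
have b0 : 0 <= b by apply: le_trans (phib 0%N); exact: rnorm_ge0.
have [->|x0] := eqVneq x 0; first by rewrite rnorm0 mulr0 mulr_ge0//; have := eps0; lra.
have nx := rnorm_gt0 x0.
have [g0 [g0l g0b g0x]] := hahn_banach x.
pose P s : set (X -> K) := [set y | exists c, y = L s c].
have split s g : dual_ball 2 g -> exists2 y, dual_ball 2 y /\ P s y &
    splits d s.+1 (delta s) y g.
  move=> gb; have [c cP] := ILs s g gb; exists (L s c) => //.
  by split; [exact: ILb|exists c].
have [g [y [gE gb yP gS yS]]] := greedy_decomposition split (conj g0l g0b).
(* The previous splitting controls exactly the first [s] vectors, with tolerance
   [delta s.-1 = 4 * delta s]; for [s = 0] there are none. *)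
have g_small s i : (i < s)%N -> rnorm (g s (d i)) <= 4 * delta s.
  case: s => // s si; have [_ [/(_ i si) + _] _] := yS s.
  by rewrite gS addrC addKr -deltaS.
have y_small s i : (i < s)%N -> rnorm (y s (d i)) <= 8 * delta s.
  move=> si; have -> : y s (d i) = g s (d i) - g s.+1 (d i) by rewrite gS addrK.
  apply: le_trans (@ler_rnormB _ _ K^o _ _) _.
  have := g_small s i si; have := g_small s.+1 i (leqW si).
  have := deltaS s; have := delta0 s; lra.
have phi_y s : rnorm (normalize s (y s) x) <= b.
  have [c yc] := yP s; apply: le_trans (phib (pickle (Tagged I c : {s & I s}))).
  by rewrite /phi pickleK_inv /= yc.
have y_le s : rnorm (y s x) <= dnorm (y s) * b + eta s * rnorm x.
  by have [yb _ _] := yS s; exact: normalize_norming yb (y_small s) (phi_y s).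
(* The remainder lies in the ball of radius 2, so replacing [x] by [d i] costs [eps / 2 * rnorm x],
   as much as is allowed for its value at [d i]. *)
have e1 : 0 < eps / 4 * rnorm x by rewrite !mulr_gt0// invr_gt0.
have [i xi] := d_dense x e1.
have [S iS dS] : exists2 S, (i < S)%N & 4 * delta S <= eps / 2 * rnorm x.
  have /(@rnorm_cvgP R RealScalars R^o)/(_ (rnorm x / 2) (divr_gt0 nx (ltr0Sn R 1))) :
      ((4^-1 : R) ^+ n @[n --> \oo] --> (0 : R)).
    by apply: cvg_expr; rewrite ger0_norm; lra.
  move=> [N _ NP]; exists (maxn N i.+1); first exact: leq_maxr.
  have := NP (maxn N i.+1) (leq_maxl _ _).
  rewrite /= subr0 /rnorm/= ger0_norm ?exprn_ge0 ?invr_ge0// -/(rnorm x) => h.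
  rewrite /delta exprS mulrCA mulVKf// -mulrA; apply: ler_wpM2l; first exact: ltW.
  by rewrite mulrC.
have gSx : rnorm (g S x) <= eps * rnorm x.
  rewrite -(subrK (d i) x) (lfunD _ _ (gb S).1).
  apply: le_trans (@ler_rnormD _ _ K^o _ _) _; rewrite subrK.
  have h1 := (gb S).2 (x - d i); have h2 := g_small S i iS.
  apply: le_trans (lerD h1 h2) _.
  have : 2 * rnorm (x - d i) <= 2 * (eps / 4 * rnorm x) by rewrite ler_pM2l.
  by lra.
have sumE n : g0 x = \sum_(t < n) y t x + g n x.
  elim: n => [|n IH]; first by rewrite big_ord0 add0r gE.
  by rewrite big_ord_recr/= -addrA -gS.
(* The three terms come from the pieces kept, the pieces dropped and the remainder. *)
have : rnorm x <= b * (1 + eps) + eps * rnorm x + eps * rnorm x.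
  rewrite -{1}g0x (sumE S); apply: le_trans (@ler_rnormD _ _ K^o _ _) _.
  apply: lerD gSx; apply: le_trans (@ler_rnorm_sum _ _ K^o _ _ _ _) _.
  apply: (@le_trans _ _ (\sum_(t < S) (dnorm (y t) * b + eta t * rnorm x))).
    by apply: ler_sum => t _.
  rewrite big_split/= -!mulr_suml; apply: lerD.
    by rewrite mulrC; apply: ler_wpM2l => //; have [] := yS S.
  by apply: ler_wpM2r (sum_eta S); exact: rnorm_ge0.
by lra.
Qed.

End norming_sequence.

(** * Embeddings into c0 *)

Section c0_facts.
Context {R : realType} {k : scalar_kind}.
Local Notation K := (scalars R k).
Local Notation c0 := (c0 R k).
Implicit Types u v : c0.

Lemma c0_null u (e : R) : 0 < e -> \forall n \near \oo, rnorm (val u n : K) <= e.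
Proof.
have := valP u; rewrite inE => /(@rnorm_cvgP R k K^o) uP /uP.
by apply: filterS => n; rewrite subr0.
Qed.

Lemma c0_of_null (f : nat -> K) :
  (forall e : R, 0 < e -> \forall n \near \oo, rnorm (f n) <= e) -> f \in @c0_pred R k.
Proof.
move=> fP; rewrite inE; apply/(@rnorm_cvgP R k K^o) => e /fP.
by apply: filterS => n; rewrite subr0.
Qed.

Lemma c0_coord_linear (a : K) u v n :
  val (a *: u + v) n = a * val u n + val v n.
Proof. by []. Qed.

Lemma c0_coord_le u n : rnorm (val u n : K) <= rnorm u.
Proof.
rewrite c0_normE; apply: ub_le_sup; last by exists n.
have [N _ NP] := c0_null u (@ltr01 R).
exists (1 + \sum_(i < N) rnorm (val u i : K)) => _ [m _ <-].
have [mN|Nm] := ltnP m N.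
  apply: ler_wpDl => //; rewrite (bigD1 (Ordinal mN))//= lerDl.
  by apply: sumr_ge0 => i _; exact: rnorm_ge0.
apply: ler_wpDr; last exact: NP.
by apply: sumr_ge0 => i _; exact: rnorm_ge0.
Qed.

Lemma c0_norm_le u (M : R) : (forall n, rnorm (val u n : K) <= M) -> rnorm u <= M.
Proof.
move=> uM; rewrite c0_normE; apply: ge_sup; first by exists (rnorm (val u 0%N : K)), 0%N.
by move=> _ [n _ <-]; exact: uM.
Qed.

(** In each coordinate one of the two entries is at most [e]: that of [v n] before [N], that of [u]
    from [N] on. *)
Lemma c0_asymptotic_max u (v : nat -> c0) :
  (forall i (e : R), 0 < e -> \forall n \near \oo, rnorm (val (v n) i : K) <= e) ->
  forall e : R, 0 < e -> \forall n \near \oo,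
    rnorm (u + v n) <= Num.max (rnorm u) (rnorm (v n)) + e /\
    Num.max (rnorm u) (rnorm (v n)) <= rnorm (u + v n) + e.
Proof.
move=> v0 e e0; have [N _ NP] := c0_null u e0.
have : \forall n \near \oo, forall i : 'I_N, rnorm (val (v n) i : K) <= e.
  by apply: filter_forall => i; exact: v0.
apply: filterS => n vN.
have ule i : rnorm (val u i : K) <= Num.max (rnorm u) (rnorm (v n)).
  by apply: le_trans (c0_coord_le u i) _; rewrite le_max lexx.
have vle i : rnorm (val (v n) i : K) <= Num.max (rnorm u) (rnorm (v n)).
  by apply: le_trans (c0_coord_le (v n) i) _; rewrite le_max lexx orbT.
have addE i : val (u + v n) i = val u i + val (v n) i by [].
have small i : rnorm (val u i : K) <= e \/ rnorm (val (v n) i : K) <= e.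
  by have [iN|Ni] := ltnP i N; [right; exact: (vN (Ordinal iN))|left; exact: NP].
split.
  apply: c0_norm_le => i; rewrite addE; apply: le_trans (@ler_rnormD _ _ K^o _ _) _.
  by have [h|h] := small i; [rewrite addrC; apply: lerD|apply: lerD].
have s0 := rnorm_ge0 (u + v n).
rewrite ge_max; apply/andP; split; apply: c0_norm_le => i.
  have := c0_coord_le (u + v n) i; rewrite addE => h.
  have [ui|vi] := small i; first by apply: le_trans ui _; rewrite lerDr.
  rewrite -(addrK (val (v n) i) (val u i)).
  by apply: le_trans (@ler_rnormB _ _ K^o _ _) _; exact: lerD.
have := c0_coord_le (u + v n) i; rewrite addE => h.
have [ui|vi] := small i; last by apply: le_trans vi _; rewrite lerDr.
rewrite -(addrK (val u i) (val (v n) i)) [val (v n) i + _]addrC.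
by apply: le_trans (@ler_rnormB _ _ K^o _ _) _; exact: lerD.
Qed.

End c0_facts.

Lemma limn_esup_le_almost {R : realType} (u v : nat -> R) : (forall n, 0 <= v n) ->
  (forall e : R, 0 < e -> \forall n \near \oo, u n <= (1 + e) * v n + e) ->
  (limn_esup (fun n => (u n)%:E) <= limn_esup (fun n => (v n)%:E))%E.
Proof.
move=> v0 uv; apply: limn_esup_le => [n|r]; first by rewrite lee_fin.
move=> /near_lt_limn_esup vr; apply/lee_addgt0Pr => d d0; apply: limn_esup_le_near.
have r0 : 0 < r.
  by have [N _ /(_ N (leqnn N)) /=] := vr; rewrite lte_fin; exact: le_lt_trans.
(* This tolerance solves [(1 + e) * r + e = r + d]. *)
have e0 : 0 < d / (r + 1) by rewrite divr_gt0// addr_gt0.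
have dE : d / (r + 1) * (r + 1) = d by rewrite divfK// gt_eqF// addr_gt0.
near=> n; rewrite -EFinD lee_fin.
apply: (@le_trans _ _ ((1 + d / (r + 1)) * v n + d / (r + 1))).
  by near: n; exact: uv.
apply: (@le_trans _ _ ((1 + d / (r + 1)) * r + d / (r + 1))).
  rewrite lerD2r; apply: ler_wpM2l; first by rewrite addr_ge0// ltW.
  by rewrite ltW// -lte_fin; near: n.
by rewrite -[in leRHS]dE; lra.
Unshelve. all: by end_near. Qed.

Lemma subspace_val_linear {K : numFieldType} {V : normedModType K}
    (S : submodClosed V) (a : K) (u v : subspace_of S) :
  val (a *: u + v) = a *: val u + val v.
Proof. by []. Qed.

Section embedding.
Context {R : realType} {k : scalar_kind}.
Local Notation K := (scalars R k).

Lemma embedding_of_norming_sequence (X : normedModType K) (phi : nat -> X -> K) (b : R) :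
  0 <= b -> (forall n, dual_ball 1 (phi n)) ->
  (forall x (e : R), 0 < e -> \forall n \near \oo, rnorm (phi n x) <= e) ->
  (forall x M, (forall n, rnorm (phi n x) <= M) -> rnorm x <= b * M) ->
  exists X0 : submodClosed (c0 R k), (banach_mazur X (subspace_of X0) <= b%:E)%E.
Proof.
move=> b0 phib phi0 phin.
pose f x : c0 R k := exist _ (fun n => phi n x) (c0_of_null (phi0 x)).
have fl : linear f.
  by move=> a x y; apply: val_inj; apply/funext => n /=; rewrite (phib n).1.
pose T : {linear X -> c0 R k} := HB.pack f
  (GRing.isLinear.Build K X (c0 R k) *:%R f fl).
have Tle x : rnorm (T x) <= 1 * rnorm x.
  by apply: c0_norm_le => n; exact: (phib n).2.
have Tge x : rnorm x <= b * rnorm (T x).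
  by apply: phin => n; exact: (c0_coord_le (T x) n).
have [T1 [T2 [iso T1le T2le]]] := limage_isomorphism ler01 b0 Tle Tge.
eexists; apply: (@le_trans _ _ (opnorm T1 * opnorm T2)%:E).
  by apply: ereal_inf_lbound; exists T1, T2.
have [_ _ _ T2c] := iso.
rewrite lee_fin; apply: le_trans (ler_wpM2r (opnorm_ge0 T2c) T1le) _.
by rewrite mul1r.
Qed.

Lemma m_infty_embeds (X : completeNormedModType K) : separable X ->
  ~ contains_copy (ell1 R k) X -> property_m_infty X -> forall e : R, 0 < e ->
  exists X0 : submodClosed (c0 R k),
    (banach_mazur X (subspace_of X0) < (1 + e)%:E)%E.
Proof.
move=> sX noell1 mX e e0; have [d dP] := separable_sequence sX.
(* The first bound serves the greedy construction and keeps [1 - 2 * eps] positive; with the second,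
   [(1 + eps) / (1 - 2 * eps) < 1 + e]. *)
pose eps := Num.min (1 / 4) (e / 8).
have eps4 : eps <= 1 / 4 by rewrite ge_min lexx.
have eps8 : eps <= e / 8 by rewrite ge_min lexx orbT.
have eps0 : 0 < eps by rewrite lt_min !divr_gt0.
have [phi [phib phi0 phin]] := norming_null_sequence dP mX noell1 eps0 eps4.
have den : 0 < 1 - 2 * eps by lra.
pose b := (1 + eps) / (1 - 2 * eps).
have [||X0 X0P] := @embedding_of_norming_sequence X phi b _ phib phi0.
- by rewrite divr_ge0 ?(ltW den)//; lra.
- by move=> x M /phin; rewrite /b mulrAC ler_pdivlMr// mulrC.
exists X0; apply: le_lt_trans X0P _; rewrite lte_fin ltr_pdivrMr//.
have : eps * e <= 1 / 4 * e by rewrite ler_pM2r.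
lra.
Qed.

(** The isomorphism varies with [e], so the inequalities of [c0_asymptotic_max] are transported for
    each [e] separately, and [limn_esup_le_almost] absorbs the errors. *)
Lemma embeds_m_infty (X : normedModType K) :
  (forall e : R, 0 < e -> exists X0 : submodClosed (c0 R k),
    (banach_mazur X (subspace_of X0) < (1 + e)%:E)%E) -> property_m_infty X.
Proof.
move=> emb x w w0.
have key (e : R) : 0 < e -> \forall n \near \oo,
    rnorm (x + w n) <= (1 + e) * Num.max (rnorm x) (rnorm (w n)) + e /\
    Num.max (rnorm x) (rnorm (w n)) <= (1 + e) * rnorm (x + w n) + e.
  move=> e0; have [X0 /ereal_inf_lt[_ [T [T' [[TK T'K Tc T'c] ->]]]]] := emb e e0.
  rewrite lte_fin => ab.
  have a0 := opnorm_ge0 Tc; have b0 := opnorm_ge0 T'c.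
  have Ta := opnorm_bound Tc; have T'b := opnorm_bound T'c.
  move: (opnorm T) (opnorm T') a0 b0 Ta T'b ab => a b a0 b0 Ta Tb' ab.
  have Tb z : rnorm z <= b * rnorm (T z) by rewrite -{1}(TK z).
  (* The coordinates of [T] are bounded functionals on [X], so weak nullity applies to them. *)
  have coord i (d : R) : 0 < d ->
      \forall n \near \oo, rnorm (val (val (T (w n))) i : K) <= d.
    move=> d0; pose g z : K^o := val (val (T z)) i.
    have gl : linear g.
      move=> c y z; rewrite /g.
      have -> : T (c *: y + z) = c *: T y + T z by rewrite linearD linearZ.
      by rewrite subspace_val_linear c0_coord_linear.
    pose G : {linear X -> K^o} := HB.pack g (GRing.isLinear.Build K X K^o *:%R g gl).
    have Gc : continuous G.
      apply: (@rnorm_bound_continuous _ _ X K^o G a) => z.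
      by apply: le_trans (Ta z); exact: (c0_coord_le (val (T z)) i).
    have /(@rnorm_cvgP R k K^o)/(_ d d0) := w0 G Gc.
    by apply: filterS => n; rewrite subr0.
  (* Multiplication by [b] turns this tolerance into at most [e], even when [b] is 0. *)
  have e'0 : 0 < e / (b + 1) by rewrite divr_gt0//; lra.
  have be' : b * (e / (b + 1)) <= e.
    by rewrite mulrCA ger_pMr// ler_pdivrMr ?mul1r; lra.
  apply: filterS (c0_asymptotic_max (val (T x)) coord e'0) => n [].
  have -> : val (T x) + val (T (w n)) = val (T (x + w n)) by rewrite linearD.
  rewrite -[rnorm (val (T x))]/(rnorm (T x)) -[rnorm (val (T (w n)))]/(rnorm (T (w n))).
  rewrite -[rnorm (val (T (x + w n)))]/(rnorm (T (x + w n))) => h1 h2.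
  have maxa : Num.max (rnorm (T x)) (rnorm (T (w n))) <=
      a * Num.max (rnorm x) (rnorm (w n)).
    rewrite ge_max; apply/andP; split.
      by apply: le_trans (Ta x) _; apply: ler_wpM2l => //; rewrite le_max lexx.
    by apply: le_trans (Ta (w n)) _; apply: ler_wpM2l => //; rewrite le_max lexx orbT.
  have maxb : Num.max (rnorm x) (rnorm (w n)) <=
      b * Num.max (rnorm (T x)) (rnorm (T (w n))).
    rewrite ge_max; apply/andP; split.
      by apply: le_trans (Tb x) _; apply: ler_wpM2l => //; rewrite le_max lexx.
    by apply: le_trans (Tb (w n)) _; apply: ler_wpM2l => //; rewrite le_max lexx orbT.
  have step (p q m : R) : 0 <= m -> p <= b * (q + e / (b + 1)) -> q <= a * m ->
      p <= (1 + e) * m + e.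
    move=> m0 pq qm; apply: le_trans pq _; rewrite mulrDr; apply: lerD => //.
    apply: le_trans (ler_wpM2l b0 qm) _; rewrite mulrA [b * a]mulrC.
    by apply: ler_wpM2r => //; exact: ltW.
  split.
    apply: step maxa; first by rewrite le_max rnorm_ge0.
    by apply: le_trans (Tb _) _; exact: ler_wpM2l.
  apply: step (Ta (x + w n)); first exact: rnorm_ge0.
  by apply: le_trans maxb _; exact: ler_wpM2l.
rewrite -limn_esup_maxe ?rnorm_ge0//; last by move=> n; rewrite lee_fin rnorm_ge0.
have -> : (fun n => maxe (rnorm x)%:E (rnorm (w n))%:E) =
    (fun n => (Num.max (rnorm x) (rnorm (w n)))%:E).
  by apply/funext => n; rewrite EFin_max.
apply/eqP; rewrite eq_le; apply/andP; split; apply: limn_esup_le_almost.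
- by move=> n; rewrite le_max rnorm_ge0.
- by move=> e /key; apply: filterS => n [].
- by move=> n; exact: rnorm_ge0.
- by move=> e /key; apply: filterS => n [].
Qed.

End embedding.

Theorem theorem4p5 (R : realType) (k : scalar_kind)
    (X : completeNormedModType (scalars R k)) :
  separable X -> ~ contains_copy (ell1 R k) X ->
  (property_m_infty X <->
   forall e : R, 0 < e ->
     exists X0 : submodClosed (c0 R k),
       (banach_mazur X (subspace_of X0) < (1 + e)%:E)%E).
Proof.
move=> sX noell1; split; last exact: embeds_m_infty.
exact: m_infty_embeds.
Qed.
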